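(* Let $\nu>-\frac12$ and let $\mathcal{S}$ be the space of functions defined in the context. If $f\in\mathcal{S}$, then $\mathcal{F}_\nu f\in L^2(\mathbb{R}^+,y^{2\nu+1}\,dy)$. Moreover $\mathcal{F}_\nu$ is norm-preserving on $\mathcal{S}$, i.e. $\|\mathcal{F}_\nu f\|_{L^2(\mathbb{R}^+,y^{2\nu+1}dy)}=\|f\|_{L^2(\mathbb{R}^+,x^{2\nu+1}dx)}$ for all $f\in\mathcal{S}$, and $\mathcal{F}_\nu$ extends to a unitary operator on $L^2(\mathbb{R}^+,x^{2\nu+1}\,dx)$.
   Context: $\mathbb{R}^+=(0,\infty)$. $\Delta_\nu=\frac{d^2}{dx^2}+\frac{2\nu+1}{x}\frac{d}{dx}$. $J_\nu(x)=\sum_{n=0}^\infty \frac{(-1)^n}{n!\,\Gamma(n+\nu+1)}\left(\frac{x}{2}\right)^{2n+\nu}$ is the Bessel function of the first kind and $\varphi_\nu(x)=x^{-\nu}J_\nu(x)$. The Fourier--Bessel transform of order $\nu$ is $\mathcal{F}_\nu f(y)=\int_{\mathbb{R}^+}\varphi_\nu(xy)f(x)x^{2\nu+1}\,dx$ for $y\in\mathbb{R}^+$. Let $k=2(\nu+2)$ if $\nu$ is an integer and $k=2\lceil\nu+1\rceil$ if $\nu$ is not an integer. The space $\mathcal{S}$ consists of all $f\in C^{2k}(\mathbb{R}^+)\cap L^1(\mathbb{R}^+,x^{2\nu+1}\,dx)\cap L^2(\mathbb{R}^+,x^{2\nu+1}\,dx)$ such that $\Delta_\nu f,\dots,\Delta_\nu^k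 f\in L^1(\mathbb{R}^+,x^{2\nu+1}\,dx)$ and $\frac{d}{dx}f,\frac{d}{dx}\Delta_\nu f,\dots,\frac{d}{dx}\Delta_\nu^{k-1}f\in L^1(\mathbb{R}^+,x^{2\nu+1}\,dx)$, and such that $f$ and its derivatives (up to order $2k$) are bounded near $0$. *)

(* Defs.v *)
From HB Require Import structures.
From mathcomp Require Import all_boot all_order all_algebra archimedean.
From mathcomp Require Import all_classical all_reals all_analysis.
From mathcomp Require Import measurable_realfun complex.

Set Implicit Arguments.
Unset Strict Implicit.
Unset Printing Implicit Defensive.

Import Order.TTheory GRing.Theory Num.Theory.
Import numFieldNormedType.Exports.
Import Normc.

Local Open Scope classical_set_scope.
Local Open Scope ring_scope.
Local Open Scope complex_scope.

(* Functions on R^+ = (0, +oo) are represented by total functions on R; only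
   their values on Rpos matter in everything below. *)
Definition Rpos {R : realType} : set R := `]0, +oo[.

Section bessel.
Context {R : realType}.
Implicit Types (nu x y : R) (A : set R).

(* Euler's integral; it is only used at arguments x > 0. *)
Definition Gamma x : R :=
  \int[lebesgue_measure]_(t in Rpos) (t `^ (x - 1) * expR (- t)).

Definition besselJ nu x : R :=
  limn (series (fun n : nat =>
    (-1) ^+ n / (n`!%:R * Gamma (n%:R + nu + 1)) *
    (x / 2) `^ (n.*2%:R + nu))).

Definition bessel_phi nu x : R := x `^ (- nu) * besselJ nu x.

(* x^(2 nu + 1) dx on R^+, as a measure on R carried by Rpos. *)
Definition bessel_measure nu A : \bar R :=
  (\int[lebesgue_measure]_(x in A) (((fun x => x `^ (2 * nu + 1)) \_ Rpos) x)%:E)%E.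

Let bessel_density_ge0 nu x : 0 <= ((fun x => x `^ (2 * nu + 1)) \_ Rpos) x.
Proof. by apply: restrict_ge0 => {}x _; exact: powR_ge0. Qed.

Let measurable_bessel_density nu :
  measurable_fun [set: R] ((fun x : R => x `^ (2 * nu + 1)) \_ Rpos).
Proof.
apply/(measurable_restrictT _ (measurable_itv _)).
by apply: measurable_funTS; exact: measurable_powR.
Qed.

Let bessel_measure0 nu : bessel_measure nu set0 = 0%E.
Proof. by rewrite /bessel_measure integral_set0. Qed.

Let bessel_measure_ge0 nu A : (0 <= bessel_measure nu A)%E.
Proof. by apply: integral_ge0 => x _; rewrite lee_fin. Qed.

Let bessel_measure_sigma_additive nu :
  semi_sigma_additive (bessel_measure nu).
Proof.
move=> /= F mF tF mUF; rewrite /bessel_measure; apply: cvg_toP.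
  apply: ereal_nondecreasing_is_cvgn => m n mn.
  apply: lee_sum_nneg_natr => // k _ _; apply: integral_ge0 => /= x Fkx.
  by rewrite lee_fin.
rewrite ge0_integral_bigcup//=.
- apply: measurable_funTS; apply: measurableT_comp => //.
  exact: measurable_bessel_density.
- by move=> x _; rewrite lee_fin.
Qed.

HB.instance Definition _ nu := isMeasure.Build _ _ _ (bessel_measure nu)
  (bessel_measure0 nu) (bessel_measure_ge0 nu)
  (@bessel_measure_sigma_additive nu).

End bessel.

(* Measurability, integrals and derivatives of complex-valued functions of a
   real variable are taken componentwise. *)
Section complex_valued.
Context {R : realType}.
Implicit Types (mu : {measure set R -> \bar R}) (f g : R -> R[i]).

Definition re_fun f : R -> R := fun x => complex.Re (f x).
Definition im_fun f : R -> R := fun x => complex.Im (f x).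

Definition cmeasurable (D : set R) f :=
  measurable_fun D (re_fun f) /\ measurable_fun D (im_fun f).

Definition cintegrable mu (D : set R) f :=
  mu.-integrable D (EFin \o re_fun f) /\ mu.-integrable D (EFin \o im_fun f).

Definition cintegral mu (D : set R) f : R[i] :=
  (\int[mu]_(x in D) re_fun f x) +i* (\int[mu]_(x in D) im_fun f x).

Definition cderivable f (x : R) :=
  derivable (re_fun f) x 1 /\ derivable (im_fun f) x 1.

Definition cderiv f : R -> R[i] :=
  fun x => derive1 (re_fun f) x +i* derive1 (im_fun f) x.

Definition cderivn n f : R -> R[i] := iter n cderiv f.

(* n times continuously differentiable on R^+ *)
Definition Cn_pos n f :=
  [/\ forall j x, (j < n)%N -> Rpos x -> cderivable (cderivn j f) x,
      forall x, Rpos x -> {for x, continuous (re_fun (cderivn n f))} &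
      forall x, Rpos x -> {for x, continuous (im_fun (cderivn n f))}].

End complex_valued.

Section fourier_bessel.
Context {R : realType}.
Variable nu : R.
Implicit Types (f g : R -> R[i]) (U : (R -> R[i]) -> (R -> R[i])).

Local Notation m := (bessel_measure nu).

Definition L1 f := cintegrable m Rpos f.

Definition L2norm f : \bar R :=
  Lnorm m 2%:E (EFin \o ((fun x => normc (f x)) \_ Rpos)).

Definition L2 f := cmeasurable Rpos f /\ (L2norm f < +oo)%E.

Definition L2inner f g : R[i] :=
  cintegral m Rpos (fun x => f x * conjc (g x)).

(* equality as elements of the L^2 space *)
Definition ae_eq_pos f g : Prop := f = g %[ae m in Rpos].

Definition bessel_op f : R -> R[i] :=
  fun x => cderivn 2 f x + ((2 * nu + 1) / x)%:C * cderiv f x.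

Definition bessel_opn j f : R -> R[i] := iter j bessel_op f.

Definition fourier_bessel f : R -> R[i] :=
  fun y => cintegral m Rpos (fun x => (bessel_phi nu (x * y))%:C * f x).

(* absz only turns these integers, nonnegative when nu > - 1 / 2, into nats. *)
Definition S_order : nat :=
  (2 * if nu \is a Num.int then absz (Num.floor nu + 2)%R
       else absz (Num.ceil (nu + 1)%R))%N.

Record S_space f : Prop := {
  S_space_Cn : Cn_pos (2 * S_order) f ;
  S_space_L1 : L1 f ;
  S_space_L2 : L2 f ;
  S_space_op_L1 : forall j, (1 <= j <= S_order)%N -> L1 (bessel_opn j f) ;
  S_space_deriv_op_L1 : forall j, (j < S_order)%N ->
    L1 (cderiv (bessel_opn j f)) ;
  S_space_bounded : forall j, (j <= 2 * S_order)%N ->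
    exists M : R, \forall x \near 0^'+, normc (cderivn j f x) <= M }.

(* The map induced by U on the space L^2(R^+, x^(2 nu + 1) dx) of classes of
   functions is well-defined and a unitary operator. *)
Record L2_unitary U : Prop := {
  L2_unitary_stable : forall f, L2 f -> L2 (U f) ;
  L2_unitary_ae : forall f g, L2 f -> L2 g ->
    ae_eq_pos f g -> ae_eq_pos (U f) (U g) ;
  L2_unitary_linear : forall (a : R[i]) f g, L2 f -> L2 g ->
    ae_eq_pos (U (fun x => a * f x + g x)) (fun x => a * U f x + U g x) ;
  L2_unitary_inner : forall f g, L2 f -> L2 g ->
    L2inner (U f) (U g) = L2inner f g ;
  L2_unitary_surj : forall g, L2 g -> exists2 f, L2 f & ae_eq_pos (U f) g }.

End fourier_bessel.

(* Main.v *)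
Require Import Defs.
From HB Require Import structures.
From mathcomp Require Import all_boot all_order all_algebra archimedean.
From mathcomp Require Import all_classical all_reals all_analysis.
From mathcomp Require Import measurable_realfun complex ring lra.

(** Only f in L^1 and L^2 matters, and everything reduces to Gaussians.
    Integrating the power series of phi_nu term by term shows that F_nu maps
    exp (- a x^2 / 2) to a^(- nu - 1) exp (- y^2 / (2 a)), so on the linear
    span G of the Gaussians F_nu is an involution, and it is isometric because
    the inner product of the Gaussians of parameters a and b is
    C (a + b)^(- nu - 1) while a b (1/a + 1/b) = a + b.  The functions
    1 - (1 - exp (- n a x^2))^(2^n) belong to G and tend to the indicator
    function of a bounded interval ]0, c[, so a Dynkin argument and dominated
    convergence make G dense both in L^2 and in the intersection of L^1 and
    L^2 (for the sum of the two norms).  The closure of the graph of F_nu on G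
    is therefore the graph of a symmetric isometry of L^2.  It contains
    (f, F_nu f) for every f in L^1 and L^2: since phi_nu is bounded,
    L^1-convergence yields uniform convergence of the transforms, and Fatou's
    lemma identifies the L^2-limit.  All this is done for real functions and
    transferred componentwise to complex ones. *)

Set Implicit Arguments.
Unset Strict Implicit.
Unset Printing Implicit Defensive.

Import Order.TTheory GRing.Theory Num.Theory.
Import numFieldNormedType.Exports.
Local Open Scope classical_set_scope.
Local Open Scope ring_scope.

(** * The measure of density [x^(2 nu + 1)] *)

(** Gaussian moments replace Gamma values: the coefficients of [psi] carry in their denominators
    exactly the moments that termwise integration produces, and the two cancel. The Gaussians are
    also stable under products, so polynomials in them without constant term stay in the span. This
    is what yields indicators: if [w = z^n], then [(1 - w)^(2^n)] behaves like [exp (- (2 z)^n)],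
    which jumps from 0 to 1 where the Gaussian [z] falls through 1/2. The transform of a combination
    is defined on its code, a list of coefficients and exponents, where the involution is an
    identity between lists. The objects are functions rather than classes, so the closure is kept as
    a relation [hrel]: symmetry, linearity and isometry pass to it by approximation, and only the
    existence of an image requires building a limit. Symmetry then gives surjectivity at once. Norms
    enter through their squares, with [(a + b)^2 <= (1 + d) a^2 + (1 + 1/d) b^2] in the role of the
    triangle inequality; letting [d] tend to 0 recovers exact equality of norms. *)

Lemma measurable_Rpos (R : realType) : measurable (@Rpos R).
Proof. exact: measurable_itv. Qed.
#[global] Hint Extern 0 (measurable Rpos) =>
  solve [exact: measurable_Rpos] : core.

Lemma Rpos_gt0 (R : realType) (x : R) : Rpos x <-> 0 < x.
Proof. by rewrite /Rpos /= in_itv/= andbT. Qed.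

Section density.
Local Open Scope ereal_scope.
Context d (T : measurableType d) (R : realType).
Variables (mu m : {measure set T -> \bar R}) (w : T -> R).
Hypothesis mw : measurable_fun [set: T] w.
Hypothesis w0 : forall x, (0 <= w x)%R.
Hypothesis mE : forall A, measurable A -> m A = \int[mu]_(x in A) (w x)%:E.

Import HBNNSimple.

(** The formula [mE] for sets extends to simple functions by linearity and to nonnegative functions
    by monotone convergence along [nnsfun_approx]. *)
Lemma ge0_integral_density D (f : T -> \bar R) :
  measurable D -> measurable_fun D f -> (forall x, D x -> 0 <= f x) ->
  \int[m]_(x in D) f x = \int[mu]_(x in D) (f x * (w x)%:E).
Proof.
move=> mD mf f0; pose f_ := nnsfun_approx mD mf.
have mwD : measurable_fun D (EFin \o w).
  by apply/measurable_EFinP; exact: measurable_funS mw.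
transitivity (limn (fun n => \int[m]_(x in D) (f_ n x)%:E)).
  rewrite -monotone_convergence//.
  - apply: eq_integral => y /[!inE] yD; apply/esym/cvg_lim => //.
    exact: cvg_nnsfun_approx.
  - by move=> n; apply/measurable_EFinP; exact/measurable_funTS.
  - by move=> n y _; rewrite lee_fin.
  - by move=> y _ p n mn; rewrite lee_fin; exact/lefP/nd_nnsfun_approx.
rewrite [X in limn X](_ : _ =
    (fun n => \int[mu]_(x in D) ((f_ n x)%:E * (w x)%:E))).
  rewrite -monotone_convergence//; last 3 first.
    - move=> n; apply: emeasurable_funM => //.
      by apply/measurable_EFinP; exact/measurable_funTS.
    - by move=> n x _; rewrite mule_ge0// lee_fin.
    - move=> x _ p n mn; rewrite -!EFinM lee_fin ler_wpM2r//.
      exact/lefP/nd_nnsfun_approx.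
  apply: eq_integral => x /[!inE] Dx; apply/cvg_lim => //.
  by apply: cvgeZr => //; exact: cvg_nnsfun_approx.
apply/funext => n.
have mfn r : measurable (f_ n @^-1` [set r]) by [].
transitivity (\sum_(k \in range (f_ n))
    \int[mu]_(x in D) ((k * \1_(f_ n @^-1` [set k]) x)%:E * (w x)%:E)).
  under eq_integral do rewrite fimfunE -fsumEFin//.
  rewrite ge0_integral_fsum//; last 2 first.
  - by move=> y; exact/measurable_EFinP/measurable_funM.
  - by move=> y x _; rewrite nnfun_muleindic_ge0.
  apply: eq_fsbigr => r _; rewrite integralZl_indic_nnsfun// integral_indic//=.
  (* The index [r] comes without its membership in the range; for negative [r] the level set is
     empty and both sides vanish. *)
  have [r0|r0] := ltP r 0%R.
    rewrite (_ : f_ n @^-1` [set r] = set0); last exact: preimage_nnfun0.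
    rewrite set0I measure0 mule0 integral0_eq// => x _.
    by rewrite indic0 mulr0 mul0e.
  under eq_integral do rewrite EFinM -muleA.
  rewrite ge0_integralZl//; last 2 first.
  - apply: emeasurable_funM => //.
    by apply/measurable_EFinP; exact/measurable_funTS.
  - by move=> x _; rewrite mule_ge0// lee_fin.
  congr (_ * _); rewrite mE; last exact: measurableI.
  rewrite setIC integral_mkcondr; apply: eq_integral => x _.
  by rewrite /patch indicE; case: (x \in _); rewrite ?mul1e ?mul0e.
rewrite -ge0_integral_fsum//.
- apply: eq_integral => x _; rewrite [in RHS]fimfunE -fsumEFin// muleC.
  rewrite ge0_mule_fsumr; last by move=> k; rewrite nnfun_muleindic_ge0.
  by apply: eq_fsbigr => k _; rewrite muleC.
- move=> r; apply: emeasurable_funM => //.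
  by apply/measurable_EFinP; exact/measurable_funM.
- move=> r x _; rewrite mule_ge0 ?lee_fin//.
  by rewrite -lee_fin nnfun_muleindic_ge0.
Qed.

End density.

Section bessel_measure_facts.
Context {R : realType} (nu : R).
Hypothesis nu_gt : - (1 / 2) < nu.
Local Notation m := (bessel_measure nu).
Local Notation mu := (@lebesgue_measure R).

(* [bessel_measure nu] lives on [R] with its default measurable structure,
   whereas [lebesgue_measure] lives on [measurableTypeR R]. *)
Let idTR : measurableTypeR R -> R := idfun.

Let measurable_idTR : measurable_fun [set: measurableTypeR R] idTR.
Proof. by move=> _ A mA; rewrite setTI. Qed.

HB.instance Definition _ :=
  @isMeasurableFun.Build _ _ (measurableTypeR R) R idTR measurable_idTR.

Let integral_idTR D (f : R -> \bar R) : measurable D ->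
  measurable_fun D f -> (forall x, D x -> (0 <= f x)%E) ->
  (\int[pushforward mu idTR]_(x in D) f x = \int[mu]_(x in D) f x)%E.
Proof.
move=> mD mf f0; rewrite ge0_integral_pushforward//.
by move=> x; rewrite inE; exact: f0.
Qed.

Lemma ge0_integral_bessel_measure D (f : R -> \bar R) : measurable D ->
  D `<=` Rpos ->
  measurable_fun D f -> (forall x, D x -> (0 <= f x)%E) ->
  (\int[m]_(x in D) f x =
   \int[mu]_(x in D) (f x * (x `^ (2 * nu + 1))%:E))%E.
Proof.
move=> mD DR mf f0.
pose w : R -> R := (fun x => x `^ (2 * nu + 1)) \_ Rpos.
have mw : measurable_fun [set: R] w.
  apply/(measurable_restrictT _ (@measurable_Rpos R)).
  by apply: measurable_funTS; exact: measurable_powR.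
have w0 x : 0 <= w x by apply: restrict_ge0 => {}x _; exact: powR_ge0.
rewrite (@ge0_integral_density _ _ _ (pushforward mu idTR) m w)//.
- rewrite integral_idTR//.
  + apply: eq_integral => x /set_mem xD.
    by rewrite /w patchE mem_set//; exact: DR.
  + apply: emeasurable_funM => //; apply/measurable_EFinP.
    exact: measurable_funTS.
  + by move=> x Rx; rewrite mule_ge0 ?f0// lee_fin.
- move=> A mA; rewrite integral_idTR//.
  + by apply/measurable_EFinP; exact: measurable_funTS.
  + by move=> x _; rewrite lee_fin.
Qed.

End bessel_measure_facts.

(** * The substitution [t = s x^2 / 2] on the half-line *)

Section quadratic_substitution.
Context {R : realType}.
Local Notation mu := (@lebesgue_measure R).
Variable s : R.
Hypothesis s0 : 0 < s.
Let F (x : R) := s / 2 * x ^+ 2.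
(** Compact intervals exhausting [Rpos], with images [FA n] under [F]. The integrand is controlled
    only inside [Rpos] and may blow up at 0, so the substitution is made on each interval and
    monotone convergence does the rest. *)
Let A (n : nat) : set R := `[n.+1%:R^-1, n.+1%:R].
Let FA (n : nat) : set R := `[F n.+1%:R^-1, F n.+1%:R].

Let F_incr (x y : R) : 0 <= x -> x < y -> F x < F y.
Proof.
move=> x0 xy; rewrite /F ltr_pM2l ?divr_gt0// ltr_pXn2r// nnegrE//.
by rewrite (le_trans x0)// ltW.
Qed.

Let F_le (x y : R) : 0 <= x -> x <= y -> F x <= F y.
Proof.
by move=> x0; rewrite le_eqVlt => /predU1P[->//|xy]; exact/ltW/F_incr.
Qed.

Let invS_le (n p : nat) : (n <= p)%N -> p.+1%:R^-1 <= n.+1%:R^-1 :> R.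
Proof. by move=> np; rewrite lef_pV2 ?posrE// ler_nat ltnS. Qed.

Let nd_A : nondecreasing_seq A.
Proof.
move=> n p np; rewrite /A subsetEset => x /=; rewrite !in_itv/= => /andP[h1 h2].
by rewrite (le_trans _ h1) ?invS_le//= (le_trans h2)// ler_nat ltnS.
Qed.

Let nd_FA : nondecreasing_seq FA.
Proof.
move=> n p np; rewrite /FA subsetEset => x /=; rewrite !in_itv/= => /andP[h1 h2].
rewrite (le_trans _ h1) ?F_le ?invS_le//=.
by rewrite (le_trans h2)// F_le// ler_nat ltnS.
Qed.

Let archi (x : R) : exists n : nat, x <= n.+1%:R.
Proof.
exists (Num.truncn x); rewrite ltW//.
by have [x0|x0] := leP 0 x; [exact: truncnS_gt|exact: (lt_le_trans x0)].
Qed.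

Let invS_ge (x : R) (n : nat) : 0 < x -> x^-1 <= n.+1%:R -> n.+1%:R^-1 <= x.
Proof. by move=> x0 h; rewrite -[leRHS]invrK lef_pV2 ?posrE ?invr_gt0. Qed.

Let bigcup_A : \bigcup_n A n = @Rpos R.
Proof.
apply/seteqP; split => x.
  move=> [n _]; rewrite /A /Rpos /= !in_itv/= andbT => /andP[+ _].
  exact: lt_le_trans.
move=> /Rpos_gt0 x0; have [n1 hn1] := archi x; have [n2 hn2] := archi x^-1.
exists (maxn n1 n2) => //; rewrite /A /= in_itv/=; apply/andP; split.
  by apply: invS_ge => //; rewrite (le_trans hn2)// ler_nat ltnS leq_maxr.
by rewrite (le_trans hn1)// ler_nat ltnS leq_maxl.
Qed.

Let bigcup_FA : \bigcup_n FA n = @Rpos R.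
Proof.
apply/seteqP; split => x.
  move=> [n _]; rewrite /FA /Rpos /= !in_itv/= andbT => /andP[+ _].
  apply: lt_le_trans.
  by rewrite /F mulr_gt0 ?divr_gt0// exprn_gt0.
move=> /Rpos_gt0 x0; pose y := Num.sqrt (x / (s / 2)).
have y0 : 0 < y by rewrite sqrtr_gt0 divr_gt0// divr_gt0.
have -> : x = F y.
  rewrite /F sqr_sqrtr ?divr_ge0 ?(ltW x0)// ?ltW// ?divr_gt0//.
  by rewrite mulrC divfK// gt_eqF// divr_gt0.
have : Rpos y by apply/Rpos_gt0.
rewrite -bigcup_A => -[n _]; rewrite /A/= in_itv/= => /andP[h1 h2].
by exists n => //; rewrite /FA /= in_itv/= !F_le// ltW.
Qed.

Let derF (x : R) : is_derive x (1:R) F (s * x).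
Proof.
rewrite /F; apply: is_derive_eq.
by rewrite /GRing.scale/=; field.
Qed.

Let derF1 : derive1 F = (fun x => s * x).
Proof.
by apply/funext => x; rewrite derive1E; have := derF x => h; rewrite derive_val.
Qed.

Let cF : continuous F.
Proof.
by move=> x; apply: differentiable_continuous; apply/derivable1_diffP; exact: ex_derive.
Qed.

Let cF' : continuous (fun x => s * x).
Proof. by move=> x; apply: cvgM; [exact: cvg_cst|exact: cvg_id]. Qed.

Lemma integral_Rpos_quadratic (G : R -> R) :
  (forall x, Rpos x -> {for x, continuous G}) ->
  (forall x, Rpos x -> 0 <= G x) ->
  (\int[mu]_(x in Rpos) (G x)%:E =
   \int[mu]_(x in Rpos) (G (s / 2 * x ^+ 2) * (s * x))%:E)%E.
Proof.
move=> cG G0.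
have ARpos n : A n `<=` Rpos by rewrite -bigcup_A => x; exists n.
have FARpos n : FA n `<=` Rpos by rewrite -bigcup_FA => x; exists n.
have FRpos x : Rpos x -> Rpos (F x).
  by move=> /Rpos_gt0 x0; apply/Rpos_gt0; rewrite /F mulr_gt0 ?divr_gt0// exprn_gt0.
have mG : @measurable_fun _ _ (measurableTypeR R) R Rpos G.
  apply: open_continuous_measurable_fun; first exact: interval_open.
  by move=> x /set_mem/cG.
have cH x : Rpos x -> {for x, continuous (fun x => G (F x) * (s * x))}.
  move=> x0; apply: (@continuousM R R (G \o F) (fun x => s * x)).
    apply: continuous_comp; first exact: cF.
    exact/cG/FRpos.
  exact: cF'.
have mH : @measurable_fun _ _ (measurableTypeR R) R Rpos
    (fun x => G (F x) * (s * x)).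
  apply: open_continuous_measurable_fun; first exact: interval_open.
  by move=> x /set_mem/cH.
have H0 x : Rpos x -> 0 <= G (F x) * (s * x).
  move=> Rx; rewrite mulr_ge0 ?G0//; first exact: FRpos.
  by rewrite mulr_ge0 ?ltW//; exact/Rpos_gt0.
have e n : (\int[mu]_(x in FA n) (G x)%:E =
    \int[mu]_(x in A n) (G (F x) * (s * x))%:E)%E.
  have ab : n.+1%:R^-1 <= n.+1%:R :> R.
    by rewrite (@le_trans _ _ 1)// ?invf_le1// ler1n.
  rewrite /FA /A integration_by_substitution_increasing//.
  - by apply: eq_integral => x _; rewrite derF1.
  - move=> x y; rewrite !in_itv/= => /andP[x1 _] _ xy; apply: F_incr => //.
    by apply: le_trans x1.
  - by rewrite derF1 => x _; exact: cF'.
  - rewrite derF1; apply/cvg_ex; exists (s * n.+1%:R^-1).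
    by apply: cvg_at_right_filter; exact: cF'.
  - rewrite derF1; apply/cvg_ex; exists (s * n.+1%:R).
    by apply: cvg_at_left_filter; exact: cF'.
  - split.
    + by move=> x _; exact: ex_derive.
    + by apply: cvg_at_right_filter; exact: cF.
    + by apply: cvg_at_left_filter; exact: cF.
  - apply: continuous_in_subspaceT => x /set_mem xF.
    by apply: cG; exact: FARpos xF.
have mA n : measurable (A n) by exact: measurable_itv.
have mFA n : measurable (FA n) by exact: measurable_itv.
have := @ge0_nondecreasing_set_cvg_integral _ (measurableTypeR R) _ FA
  (EFin \o G) mu nd_FA mFA.
have := @ge0_nondecreasing_set_cvg_integral _ (measurableTypeR R) _ A
  (EFin \o (fun x => G (F x) * (s * x))) mu nd_A mA.
rewrite bigcup_A bigcup_FA => h1 h2.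
transitivity (limn (fun i => \int[mu]_(x in FA i) (G x)%:E)%E).
  apply/esym/cvg_lim => //; apply: h2 => n.
    by apply/measurable_EFinP; apply: measurable_funS mG;
      [exact: measurable_Rpos|exact: FARpos].
  by move=> x /FARpos Rx; rewrite lee_fin G0.
under eq_fun do rewrite e; apply/cvg_lim => //; apply: h1 => n.
  by apply/measurable_EFinP; apply: measurable_funS mH;
    [exact: measurable_Rpos|exact: ARpos].
by move=> x /ARpos Rx; rewrite lee_fin H0.
Qed.

End quadratic_substitution.

(** * Gaussian moments and the Gamma function *)

Lemma powR2M {R : realType} (x c : R) : 0 <= x -> x `^ (2 * c) = (x ^+ 2) `^ c.
Proof. by move=> x0; rewrite -powR_mulrn// powRrM. Qed.

Definition gaussian {R : realType} (s x : R) : R := expR (- (s / 2 * x ^+ 2)).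

Lemma gaussian_gt0 {R : realType} (s x : R) : 0 < gaussian s x.
Proof. exact: expR_gt0. Qed.

Lemma continuous_gaussian {R : realType} (s : R) : continuous (gaussian s).
Proof.
move=> x; apply: differentiable_continuous; apply/derivable1_diffP.
by rewrite /gaussian; exact: ex_derive.
Qed.

Lemma measurable_gaussian {R : realType} (s : R) D : measurable D ->
  measurable_fun D (gaussian s).
Proof.
by move=> mD; apply: measurable_funTS; apply: continuous_measurable_fun;
  exact: continuous_gaussian.
Qed.

Section moments.
Context {R : realType} (nu : R).
Hypothesis nu_gt : - (1 / 2) < nu.
Local Notation m := (bessel_measure nu).
Local Notation mu := (@lebesgue_measure R).

Definition moment_fun n s (x : R) : R := x ^+ n.*2 * gaussian s x.

Lemma moment_fun_ge0 n s x : 0 <= moment_fun n s x.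
Proof. by rewrite mulr_ge0 ?exprn_even_ge0 ?odd_double// ltW// gaussian_gt0. Qed.

Lemma measurable_moment_fun n s D : measurable D ->
  measurable_fun D (moment_fun n s).
Proof.
move=> mD; apply: measurable_funM; last exact: measurable_gaussian.
exact: measurable_funX.
Qed.

Definition moment n s : \bar R := (\int[m]_(x in Rpos) (moment_fun n s x)%:E)%E.

Lemma momentE n s : moment n s =
  (\int[mu]_(x in Rpos) (moment_fun n s x * x `^ (2 * nu + 1))%:E)%E.
Proof.
rewrite /moment ge0_integral_bessel_measure//.
- by apply/measurable_EFinP; exact: measurable_moment_fun.
- by move=> x _; rewrite lee_fin moment_fun_ge0.
Qed.

(** [Gamma] before its conversion to a real number, so that identities can be proved before
    finiteness is known. *)
Definition ereal_Gamma (b : R) : \bar R :=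
  (\int[mu]_(t in Rpos) (t `^ (b - 1) * expR (- t))%:E)%E.

(** The substitution [t = s x^2 / 2]. As the left-hand side does not depend on [s], comparison with
    [s = 1] gives the scaling law of the moments. *)
Lemma ereal_Gamma_moment n s : 0 < s -> ereal_Gamma (n%:R + nu + 1) =
  (((s / 2) `^ (n%:R + nu) * s)%:E * moment n s)%E.
Proof.
move=> s0; rewrite momentE /ereal_Gamma addrK.
have E (x : R) : 0 < x -> (s / 2 * x ^+ 2) `^ (n%:R + nu) *
    expR (- (s / 2 * x ^+ 2)) * (s * x) =
    (s / 2) `^ (n%:R + nu) * s * (moment_fun n s x * x `^ (2 * nu + 1)).
  move=> x0; have xn0 : x != 0 by rewrite gt_eqF.
  rewrite powRM ?divr_ge0 ?sqr_ge0 ?(ltW s0)//.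
  rewrite /moment_fun -/(gaussian s x) -powR2M ?(ltW x0)//.
  have -> : x ^+ n.*2 = x `^ (2 * n%:R).
    by rewrite -mul2n -natrM powR_mulrn// ltW.
  rewrite mulrDr [x `^ (_ + 1)]powRD ?xn0 ?implybT// powRr1 ?(ltW x0)//.
  by rewrite [x `^ (_ + 2 * nu)]powRD ?xn0 ?implybT//; ring.
rewrite (@integral_Rpos_quadratic _ _ s0 (fun t => t `^ (n%:R + nu) * expR (- t))).
- have c0 : 0 <= (s / 2) `^ (n%:R + nu) * s by rewrite mulr_ge0 ?powR_ge0 ?ltW.
  rewrite -ge0_integralZl//; last 2 first.
  + apply/measurable_EFinP; apply: measurable_funM.
      exact: (@measurable_moment_fun n s Rpos (@measurable_Rpos R)).
    by apply: measurable_funTS; exact: measurable_powR.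
  + by move=> x _; rewrite lee_fin mulr_ge0 ?moment_fun_ge0 ?powR_ge0.
  apply: eq_integral => x /set_mem /Rpos_gt0 x0; rewrite -EFinM; congr EFin.
  exact: E.
- move=> x /Rpos_gt0 x0; apply: continuousM; last first.
    apply: continuous_comp; first exact: continuousN.
    exact: continuous_expR.
  apply: differentiable_continuous; apply/derivable1_diffP.
  by apply: derivable_powR; rewrite in_itv/= andbT.
- by move=> x _; rewrite mulr_ge0 ?powR_ge0 ?expR_ge0.
Qed.

(** Up to 1 the power is at most 1; beyond 1 it is at most an integer power [x^k], and [x^k / k!] is
    one term of the exponential series. *)
Lemma powR_le_expR (p x : R) : 0 <= p -> 0 < x ->
  x `^ p <= 1 + (Num.truncn p).+1`!%:R * expR x.
Proof.
move=> p0 x0; set k := (Num.truncn p).+1.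
have [x1|x1] := leP x 1.
  rewrite (@le_trans _ _ 1)// ?lerDl ?mulr_ge0 ?expR_ge0//.
  rewrite (@le_trans _ _ (x `^ 0))//; last by rewrite powRr0.
  by apply: ger_powR; rewrite ?x0.
rewrite (@le_trans _ _ (x ^+ k))//.
  rewrite -powR_mulrn ?(ltW x0)//; apply: ler_powR; first exact: ltW.
  by rewrite ltW// truncnS_gt.
rewrite ler_wpDl// mulrC -ler_pdivrMr ?ltr0n ?fact_gt0//.
by apply: le_trans (expR_ge1Dxn (Num.truncn p) (ltW x0)); rewrite lerDr.
Qed.

Lemma moment_lty n : (moment n 1 < +oo)%E.
Proof.
rewrite momentE; pose p := n.*2%:R + (2 * nu + 1).
have p0 : 0 <= p.
  by rewrite addr_ge0//; move: nu_gt; lra.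
(* The factor [expR 2] comes from [x - x^2 / 2 <= 2 - x], that is [(x - 2)^2 >= 0]; the integrand is
   then dominated by a multiple of the exponential density. *)
pose C : R := expR 2 * (1 + (Num.truncn p).+1`!%:R).
have C0 : 0 <= C by rewrite mulr_ge0 ?expR_ge0// addr_ge0.
have key (x : R) : 0 < x ->
    moment_fun n 1 x * x `^ (2 * nu + 1) <= C * expR (- x).
  move=> x0; rewrite /moment_fun mulrAC -powR_mulrn ?(ltW x0)// -powRD; last first.
    by rewrite (gt_eqF x0) implybT.
  rewrite -/p.
  rewrite (@le_trans _ _ ((1 + (Num.truncn p).+1`!%:R) * expR x * gaussian 1 x))//.
    rewrite ler_pM2r ?gaussian_gt0//.
    rewrite (le_trans (powR_le_expR p0 x0))// mulrDl mul1r lerD2r.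
    by rewrite -expR0 ler_expR ltW.
  rewrite -mulrA /C [expR 2 * _]mulrC -[leRHS]mulrA ler_wpM2l ?addr_ge0//.
  rewrite /gaussian -!expRD ler_expR.
  by have := sqr_ge0 (x - 2); nra.
apply: (@le_lt_trans _ _
    (\int[mu]_(x in Rpos) (C%:E * (exponential_pdf 1 x)%:E))%E).
  apply: ge0_le_integral => //.
  - by move=> x _; rewrite lee_fin mulr_ge0 ?moment_fun_ge0 ?powR_ge0.
  - apply/measurable_EFinP; apply: measurable_funM.
      exact: (@measurable_moment_fun n 1 Rpos (@measurable_Rpos R)).
    by apply: measurable_funTS; exact: measurable_powR.
  - apply/measurable_EFinP; apply: measurable_funM => //.
    by apply: measurable_funTS; exact: measurable_exponential_pdf.
  - move=> x /Rpos_gt0 x0.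
    rewrite -EFinM lee_fin exponential_pdfE ?(ltW x0)//= mul1r mulN1r.
    exact: key.
rewrite ge0_integralZl//; last 2 first.
- by apply/measurable_EFinP; apply: measurable_funTS; exact: measurable_exponential_pdf.
- by move=> x _; rewrite lee_fin exponential_pdf_ge0.
rewrite lte_mul_pinfty// ?lee_fin//.
apply: (@le_lt_trans _ _ (\int[mu]_x (exponential_pdf 1 x)%:E)%E).
  apply: ge0_subset_integral => //.
  - by apply/measurable_EFinP; exact: measurable_exponential_pdf.
  - by move=> x _; rewrite lee_fin exponential_pdf_ge0.
by rewrite integral_exponential_pdf// ltry.
Qed.

Definition moment1 n : R := fine (moment n 1).

Lemma moment1E n : (moment1 n)%:E = moment n 1.
Proof.
rewrite /moment1 fineK// ge0_fin_numE ?moment_lty//.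
by apply: integral_ge0 => x _; rewrite lee_fin moment_fun_ge0.
Qed.

(** Finiteness for every [s] is part of the claim: a positive multiple of [moment n s] equals a
    finite value obtained at [s = 1], which excludes [+oo]. *)
Lemma moment_scale n s : 0 < s ->
  moment n s = (s `^ (- (n%:R + nu + 1)) * moment1 n)%:E.
Proof.
move=> s0; have := ereal_Gamma_moment n s0.
rewrite (ereal_Gamma_moment n ltr01) -moment1E -EFinM.
have c0 : 0 < (s / 2) `^ (n%:R + nu) * s by rewrite mulr_gt0 ?powR_gt0 ?divr_gt0.
have M0 : (0 <= moment n s)%E.
  by apply: integral_ge0 => x _; rewrite lee_fin moment_fun_ge0.
case: (moment n s) M0 => [r| |] // _; last by rewrite gt0_muley ?lte_fin.
rewrite -EFinM => -[]; rewrite mulr1 div1r powRM ?invr_ge0 ?(ltW s0)// => h.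
congr EFin.
have h2 : 0 < 2^-1 `^ (n%:R + nu) :> R by rewrite powR_gt0.
have : moment1 n = s `^ (n%:R + nu + 1) * r.
  rewrite powRD; last by rewrite (gt_eqF s0) implybT.
  rewrite powRr1 ?(ltW s0)//.
  by apply: (mulfI (lt0r_neq0 h2)); rewrite h; ring.
by move=> ->; rewrite powRN mulKf// gt_eqF// powR_gt0.
Qed.

Lemma Gamma_moment1 n :
  Gamma (n%:R + nu + 1) = 2 `^ (- (n%:R + nu)) * moment1 n.
Proof.
have := ereal_Gamma_moment n ltr01.
rewrite -moment1E -EFinM /Gamma /Rintegral /ereal_Gamma => ->.
by rewrite /= mulr1 div1r -(powR_inv1 (ler0n _ 2)) -powRrM mulN1r.
Qed.

(** On [[1, 2]] both powers of [x] are at least 1 and the Gaussian is at least [expR (-2)]. *)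
Lemma moment1_gt0 n : 0 < moment1 n.
Proof.
have key (x : R) : 1 <= x <= 2 ->
    ((expR (-2))%:E <= (moment_fun n 1 x * x `^ (2 * nu + 1))%:E)%E.
  move=> /andP[x1 x2]; have x0 : 0 <= x by rewrite (le_trans _ x1).
  rewrite lee_fin /moment_fun mulrAC -[leLHS]mul1r ler_pM ?expR_ge0//.
    rewrite -[leLHS]mulr1 ler_pM// ?exprn_ege1//.
    by rewrite -[leLHS](powRr0 x); apply: ler_powR => //; move: nu_gt; lra.
  by rewrite /gaussian ler_expR lerN2; nra.
rewrite -lte_fin moment1E momentE.
apply: (@lt_le_trans _ _ (\int[mu]_(x in `[1%R, 2%R]) (expR (-2))%:E)%E).
  rewrite integral_cst//= lebesgue_measure_itv/= lte_fin ltr1n/=.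
  by rewrite -EFinB -EFinM lte_fin mulr_gt0 ?expR_gt0// subr_gt0 ltr1n.
have sub : `[1, 2] `<=` @Rpos R.
  move=> x; rewrite /Rpos/= !in_itv/= andbT => /andP[+ _].
  exact: lt_le_trans.
have mM : @measurable_fun _ _ (measurableTypeR R) R Rpos
    (fun x : R => moment_fun n 1 x * x `^ (2 * nu + 1)).
  apply: measurable_funM.
    exact: (@measurable_moment_fun n 1 Rpos (@measurable_Rpos R)).
  by apply: measurable_funTS; exact: measurable_powR.
apply: (@le_trans _ _ (\int[mu]_(x in `[1%R, 2%R])
    (moment_fun n 1 x * x `^ (2 * nu + 1))%:E)%E).
  apply: ge0_le_integral => //.
  apply/measurable_EFinP.
  exact: (@measurable_funS _ _ (measurableTypeR R) R Rpos _ _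
    (@measurable_Rpos R) sub mM).
apply: ge0_subset_integral => //.
- exact/measurable_EFinP.
- by move=> x _; rewrite lee_fin mulr_ge0 ?moment_fun_ge0 ?powR_ge0.
Qed.

Lemma integrable_moment_fun n s : 0 < s ->
  m.-integrable Rpos (EFin \o moment_fun n s).
Proof.
move=> s0; apply/integrableP; split.
  by apply/measurable_EFinP; exact: measurable_moment_fun.
under eq_integral do rewrite /= ger0_norm ?moment_fun_ge0//.
by rewrite -/(moment n s) moment_scale// ltry.
Qed.

(* Integrating [expR (- u) >= 1 - u] with [u = (s - 1) x^2 / 2] against the
   Gaussian shows that the function [h] below is nonnegative; it vanishes
   at [s = 1], and its critical-point equation there is the recursion. *)
Lemma moment1S n : moment1 n.+1 = 2 * (n%:R + nu + 1) * moment1 n.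
Proof.
pose q := n%:R + nu + 1.
pose h s := s `^ (- q) * moment1 n - moment1 n + (s - 1) / 2 * moment1 n.+1.
have h0 (s : R) : 0 < s -> 0 <= h s.
  move=> s0.
  have Rmoment k t : 0 < t -> (\int[m]_(x in Rpos) moment_fun k t x)%R =
      t `^ (- (k%:R + nu + 1)) * moment1 k.
    move=> t0; rewrite /Rintegral.
    by have := moment_scale k t0; rewrite /moment => ->.
  have i1 := integrable_moment_fun n s0.
  have i2 := integrable_moment_fun n (@ltr01 R).
  have i3 := integrable_moment_fun n.+1 (@ltr01 R).
  have i4 : m.-integrable Rpos
      (EFin \o (fun x => (s - 1) / 2 * moment_fun n.+1 1 x)).
    by apply: eq_integrable (integrableZl _ ((s - 1) / 2) i3) => //.
  have -> : h s = \int[m]_(x in Rpos) (moment_fun n s x - moment_fun n 1 x +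
                    (s - 1) / 2 * moment_fun n.+1 1 x).
    rewrite RintegralD//; last exact: (integrableB (@measurable_Rpos R) i1 i2).
    rewrite RintegralB// RintegralZl// !Rmoment//.
    by rewrite !powR1 !mul1r.
  apply: Rintegral_ge0 => x _.
  rewrite /moment_fun doubleS !exprS.
  have -> : gaussian s x = expR (- ((s - 1) / 2 * x ^+ 2)) * gaussian 1 x.
    by rewrite /gaussian -expRD; congr expR; field.
  rewrite [leRHS](_ : _ = x ^+ n.*2 * gaussian 1 x *
    (expR (- ((s - 1) / 2 * x ^+ 2)) - (1 + - ((s - 1) / 2 * x ^+ 2)))); last first.
    by ring.
  by rewrite mulr_ge0 ?moment_fun_ge0// subr_ge0 expR_ge1Dx.
have h1 : h 1 = 0 by rewrite /h powR1 mul1r !subrr !mul0r addr0.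
have dh (s : R) : 0 < s ->
    is_derive s (1:R) h (- q * s `^ (- q - 1) * moment1 n + 2^-1 * moment1 n.+1).
  move=> s0; rewrite /h.
  have ? := is_derive1_powR (- q) s0.
  by apply: is_derive_eq; rewrite /GRing.scale/=; ring.
have min1 : is_derive (1:R) (1:R) h 0.
  apply: (@derive1_at_min _ h 0 2 1) => //.
  - by move=> t; rewrite in_itv/= => /andP[t0 _]; have := dh t t0 => ?; exact: ex_derive.
  - by rewrite in_itv/= ltr01 ltr1n.
  - by move=> t; rewrite in_itv/= h1 => /andP[t0 _]; exact: h0.
have := dh 1 ltr01 => d1.
have := @derive_val _ _ _ _ _ _ _ d1; rewrite (@derive_val _ _ _ _ _ _ _ min1).
by rewrite powR1 mulr1 -/q => e; lra.
Qed.

End moments.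

(** * The Bessel function *)

Section entire_series.
Context {R : realType}.

Lemma is_cvg_pseries_fact (a : R^nat) (C : R) :
  (forall n, `|a n| <= C / n`!%:R) -> forall x, cvgn (pseries a x).
Proof.
move=> aC x; apply: normed_cvg.
have C0 : 0 <= C.
  by have := aC 0%N; rewrite fact0 divr1; apply: le_trans.
apply: (@series_le_cvg _ _ (fun n => C * exp_coeff `|x| n)).
- by move=> n; exact: normr_ge0.
- by move=> n; rewrite mulr_ge0// /exp_coeff/= divr_ge0// exprn_ge0.
- move=> n; rewrite /= normrM normrX /exp_coeff/= mulrCA mulrC.
  by rewrite ler_wpM2l ?exprn_ge0.
exact: (@is_cvg_seriesZ _ _ C (is_cvg_series_exp_coeff `|x|)).
Qed.

End entire_series.

Section bessel_phi_facts.
Context {R : realType} (nu : R).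
Hypothesis nu_gt : - (1 / 2) < nu.
Local Notation M := (moment1 nu).

(* [bessel_phi nu x] is the value at [x ^+ 2] of the entire function [psi];
   the Gamma factors are absorbed in the Gaussian moments. *)
Definition psi_coeff (n : nat) : R := (-1) ^+ n / (n`!%:R * 2 ^+ n * M n).

Definition psi (s : R) : R := limn (pseries psi_coeff s).

Let M0 n : 0 < M n. Proof. exact: moment1_gt0. Qed.

(** Consecutive moments have ratio [2 * (n%:R + nu + 1)], at least 1 because [nu > - 1 / 2]. *)
Let M_ndec n : M 0 <= M n.
Proof.
elim: n => // n /le_trans; apply; rewrite moment1S// ler_peMl ?ltW//.
have : 0 <= n%:R :> R by [].
by move: nu_gt; lra.
Qed.

(** Two indices, because differentiating the series lowers the factorial but not the moment: one
    bound serves [psi] and its three derived series. *)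
Let norm_psi_coeff n k : `|(-1) ^+ n / (k`!%:R * 2 ^+ n * M n)| <= (M 0)^-1 / k`!%:R.
Proof.
have p2 : 1 <= 2 ^+ n :> R by rewrite exprn_ege1// ler1n.
have pk : 0 < k`!%:R :> R by rewrite ltr0n fact_gt0.
have pD : 0 < k`!%:R * 2 ^+ n * M n by rewrite !mulr_gt0// (lt_le_trans ltr01).
rewrite normrM normrX normrN1 expr1n mul1r normfV (gtr0_norm pD).
rewrite -invfM lef_pV2 ?posrE ?(mulr_gt0 (M0 _))//.
rewrite mulrC -mulrA ler_wpM2l ?(ltW pk)//.
by rewrite -[leLHS]mul1r ler_pM// ltW.
Qed.

Let psi_coeffS n : psi_coeff n.+1 =
  - psi_coeff n / (4 * (n%:R + nu + 1) * n.+1%:R).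
Proof.
rewrite /psi_coeff moment1S// factS natrM !exprS.
have : M n != 0 by rewrite gt_eqF.
have : n`!%:R != 0 :> R by rewrite pnatr_eq0 -lt0n fact_gt0.
have : n%:R + nu + 1 != 0.
  rewrite gt_eqF//; have : 0 <= n%:R :> R by [].
  by move: nu_gt; lra.
have : 2 ^+ n != 0 :> R by rewrite expf_neq0// pnatr_eq0.
have : n.+1%:R != 0 :> R by rewrite pnatr_eq0.
by move=> *; field; do ?[apply/andP; split].
Qed.

Let cvg_psi s : cvgn (pseries psi_coeff s).
Proof. by apply: (@is_cvg_pseries_fact _ _ (M 0)^-1) => n; exact: norm_psi_coeff. Qed.

Let d1 := pseries_diffs psi_coeff.
Let d2 := pseries_diffs d1.

Let d1E n : d1 n = (-1) ^+ n.+1 / (n`!%:R * 2 ^+ n.+1 * M n.+1).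
Proof.
rewrite /d1 /pseries_diffs /psi_coeff factS natrM mulrCA; congr (_ * _).
have n0 : n.+1%:R != 0 :> R by rewrite pnatr_eq0.
by rewrite -!mulrA invfM mulVKf.
Qed.

Let d2E n : d2 n = (-1) ^+ n.+2 / (n`!%:R * 2 ^+ n.+2 * M n.+2).
Proof.
rewrite /d2 /pseries_diffs d1E factS natrM mulrCA; congr (_ * _).
have n0 : n.+1%:R != 0 :> R by rewrite pnatr_eq0.
by rewrite -!mulrA invfM mulVKf.
Qed.

Let cvg_d1 s : cvgn (pseries d1 s).
Proof.
apply: (@is_cvg_pseries_fact _ _ (M 0)^-1) => n.
by rewrite d1E -addn1; exact: norm_psi_coeff.
Qed.

Let cvg_d2 s : cvgn (pseries d2 s).
Proof.
apply: (@is_cvg_pseries_fact _ _ (M 0)^-1) => n.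
by rewrite d2E -addn2; exact: norm_psi_coeff.
Qed.

(** [pseries_snd_diffs] differentiates a series whose first two derived series converge; applied to
    [psi1], it calls for the third derived series of [psi]. *)
Let d3E n : pseries_diffs d2 n = (-1) ^+ n.+3 / (n`!%:R * 2 ^+ n.+3 * M n.+3).
Proof.
rewrite /pseries_diffs d2E factS natrM mulrCA; congr (_ * _).
have n0 : n.+1%:R != 0 :> R by rewrite pnatr_eq0.
by rewrite -!mulrA invfM mulVKf.
Qed.

Let cvg_d3 s : cvgn (pseries (pseries_diffs d2) s).
Proof.
apply: (@is_cvg_pseries_fact _ _ (M 0)^-1) => n.
by rewrite d3E -addn3; exact: norm_psi_coeff.
Qed.

Let psi1 s := limn (pseries d1 s).
Let psi2 s := limn (pseries d2 s).

Let norm_lt (s : R) : `|s| < `| `|s| + 1 |.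
Proof. by rewrite [ltRHS]ger0_norm ?addr_ge0// ltrDl. Qed.

Let is_derive_psi (s : R) : is_derive s (1:R) psi (psi1 s).
Proof. exact: (@pseries_snd_diffs R psi_coeff (`|s| + 1) s (@cvg_psi _) (@cvg_d1 _)
  (@cvg_d2 _) (norm_lt s)). Qed.

Let is_derive_psi1 (s : R) : is_derive s (1:R) psi1 (psi2 s).
Proof. exact: (@pseries_snd_diffs R d1 (`|s| + 1) s (@cvg_d1 _) (@cvg_d2 _)
  (@cvg_d3 _) (norm_lt s)). Qed.

(** Bessel's equation [phi'' + (2 nu + 1) phi' / x + phi = 0] in the variable [s = x^2]. *)
Let psi_ode s : 4 * s * psi2 s + 4 * (nu + 1) * psi1 s + psi s = 0.
Proof.
have h2 := pseries_diffs_equiv (@cvg_d2 s).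
have h1 := @cvg_d1 s; have h0 := @cvg_psi s.
(* Already the partial sums vanish: the coefficient of [s^i] is [4 (i + nu + 1) (i + 1) psi_coeff
   i.+1 + psi_coeff i], which is 0 by [psi_coeffS]. *)
have e : 4 * s *: series (fun i => i%:R * d1 i * s ^+ i.-1) +
    4 * (nu + 1) *: pseries d1 s + pseries psi_coeff s = (fun=> 0).
  apply/funext => n; rewrite /pseries /series /= !fctE /GRing.scale/=.
  rewrite !mulr_sumr -!big_split/= big1// => i _.
  have -> : 4 * s * (i%:R * d1 i * s ^+ i.-1) = 4 * i%:R * d1 i * s ^+ i.
    case: i => [|i]; first by rewrite !(mulr0, mul0r).
    by rewrite exprS/=; ring.
  rewrite {1 2}/d1 /pseries_diffs psi_coeffS.
  have : i%:R + nu + 1 != 0.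
    rewrite gt_eqF//; have : 0 <= i%:R :> R by [].
    by move: nu_gt; lra.
  have : i.+1%:R != 0 :> R by rewrite pnatr_eq0.
  by move=> *; field; do ?[apply/andP; split].
apply/esym/(@cvg_unique _ (@Rhausdorff R) ((fun=> 0 : R) n @[n --> \oo])).
  exact: cvg_cst.
rewrite -{1}e; apply: cvgD => //; apply: cvgD.
- exact: cvgZl_tmp h2.
- exact: cvgZl_tmp h1.
Qed.

Let psi0 : psi 0 = (M 0)^-1.
Proof.
rewrite /psi; apply/cvg_lim => //; rewrite -(cvg_shiftn 1).
rewrite (_ : (fun n => _) = (fun=> (M 0)^-1)); first exact: cvg_cst.
apply/funext => n; rewrite /pseries /series/= addn1 big_nat_recl//= big1 => [|i _].
  by rewrite addr0 expr0 mulr1 /psi_coeff !expr0 fact0 !mul1r.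
by rewrite expr0n mulr0.
Qed.

(* The energy [psi ^+ 2 + 4 s psi' ^+ 2] is nonincreasing on the half-line. *)
Lemma psi_bound s : 0 <= s -> `|psi s| <= (M 0)^-1.
Proof.
move=> s0; pose E s := psi s ^+ 2 + 4 * s * psi1 s ^+ 2.
have dE (t : R) : is_derive t (1:R) E (- 4 * (2 * nu + 1) * psi1 t ^+ 2).
  have d0 := is_derive_psi t; have d1' := is_derive_psi1 t.
  rewrite /E; apply: is_derive_eq; rewrite /GRing.scale/=.
  have := psi_ode t; have -> : psi t = - (4 * t * psi2 t + 4 * (nu + 1) * psi1 t).
    by have := psi_ode t; lra.
  by move=> _; ring.
have cE : continuous E.
  move=> t; apply: differentiable_continuous; apply/derivable1_diffP.
  by have := dE t => ?; exact: ex_derive.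
have leE : E s <= E 0.
  apply: (@ler0_derive1_le_cc _ E 0 (s + 1)).
  - by move=> t _; have := dE t => ?; exact: ex_derive.
  - move=> t _; rewrite derive1E (@derive_val _ _ _ _ _ _ _ (dE t)).
    rewrite !mulNr oppr_le0 mulr_ge0 ?sqr_ge0// mulr_ge0//.
    by move: nu_gt; lra.
  - exact: continuous_subspaceT.
  - by rewrite in_itv/= s0 lerDl ler01.
  - by rewrite in_itv/= lexx addr_ge0.
  - by [].
have i0 : 0 <= (M 0)^-1 by rewrite invr_ge0 ltW.
rewrite -ler_sqr ?nnegrE// real_normK ?num_real//.
apply: (@le_trans _ _ (E s)); first by rewrite /E lerDl mulr_ge0 ?sqr_ge0// mulr_ge0.
by rewrite (le_trans leE)// /E psi0 mulr0 mul0r addr0.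
Qed.

Lemma bessel_phiE x : 0 < x -> bessel_phi nu x = psi (x ^+ 2).
Proof.
move=> x0; have xn0 : x != 0 by rewrite gt_eqF.
rewrite /bessel_phi /besselJ.
rewrite (_ : (fun n : nat => _) =
  (fun n => x `^ nu * (psi_coeff n * (x ^+ 2) ^+ n))); last first.
  apply/funext => n; rewrite Gamma_moment1//.
  rewrite powRM ?(ltW x0)// [x `^ (_ + _)]powRD ?xn0 ?implybT//.
  rewrite powR_mulrn ?(ltW x0)// -exprM mul2n.
  rewrite -(powR_inv1 (ler0n _ 2)) -powRrM mulN1r.
  have -> : 2 `^ (- (n.*2%:R + nu)) = 2 `^ (- (n%:R + nu)) / 2 ^+ n :> R.
    rewrite -powR_invn// -powRD; last by rewrite pnatr_eq0 implybT.
    by congr powR; rewrite -addnn natrD; ring.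
  have h1 : 2 `^ (- (n%:R + nu)) != 0 :> R by rewrite gt_eqF// powR_gt0.
  have h2 : n`!%:R != 0 :> R by rewrite pnatr_eq0 -lt0n fact_gt0.
  have h3 : 2 ^+ n != 0 :> R by rewrite expf_neq0// pnatr_eq0.
  have h4 : M n != 0 by rewrite gt_eqF.
  rewrite /psi_coeff; field; do ?[apply/andP; split] => //.
rewrite (_ : series _ = x `^ nu *: pseries psi_coeff (x ^+ 2)); last first.
  exact: (@seriesZ _ _ (fun n => psi_coeff n * (x ^+ 2) ^+ n) (x `^ nu)).
rewrite (_ : limn _ = x `^ nu * psi (x ^+ 2)); last first.
  apply/cvg_lim => //; apply: cvgZl_tmp; exact: cvg_psi.
by rewrite powRN mulKf// gt_eqF// powR_gt0.
Qed.

Lemma cvg_psi_series s : pseries psi_coeff s @ \oo --> psi s.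
Proof. exact: cvg_psi. Qed.

End bessel_phi_facts.

(** * The transform of a Gaussian *)

Section weber.
Context {R : realType} (nu : R).
Hypothesis nu_gt : - (1 / 2) < nu.
Local Notation m := (bessel_measure nu).
Local Notation M := (moment1 nu).

Let M0 n : 0 < M n. Proof. exact: moment1_gt0. Qed.

Lemma integral_moment_fun n s c : 0 < s ->
  (\int[m]_(x in Rpos) (c * moment_fun n s x)%:E =
   (c * (s `^ (- (n%:R + nu + 1)) * M n))%:E)%E.
Proof.
move=> s0; under eq_integral do rewrite EFinM.
rewrite integralZl//; last exact: integrable_moment_fun.
by rewrite -/(moment nu n s) moment_scale.
Qed.

Lemma integrable_moment_funZ n s c : 0 < s ->
  m.-integrable Rpos (fun x => (c * moment_fun n s x)%:E).
Proof.
move=> s0; apply: eq_integrable (integrableZl _ c (integrable_moment_fun nu_gt n s0)) => //.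
Qed.

(** The moment in the coefficient cancels the one produced by integration, so the termwise integrals
    form the exponential series of [- y^2 / (2 b)]. *)
Lemma psi_coeff_moment n (b y : R) : 0 < b ->
  psi_coeff nu n * (y ^+ 2) ^+ n * (b `^ (- (n%:R + nu + 1)) * M n) =
  b `^ (- (nu + 1)) * exp_coeff (- (b^-1 / 2 * y ^+ 2)) n.
Proof.
move=> b0; have bn0 : b != 0 by rewrite gt_eqF.
have -> : - (n%:R + nu + 1) = - (nu + 1) - n%:R by ring.
rewrite powRD ?bn0 ?implybT// powR_invn ?ltW// /exp_coeff/=.
rewrite /psi_coeff -mulNr -[- (b^-1 / 2)]mulN1r !exprMn !exprVn.
have h2 : n`!%:R != 0 :> R by rewrite pnatr_eq0 -lt0n fact_gt0.
have h3 : 2 ^+ n != 0 :> R by rewrite expf_neq0// pnatr_eq0.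
have h4 : M n != 0 by rewrite gt_eqF.
have h5 : b ^+ n != 0 by rewrite expf_neq0.
by field; do ?[apply/andP; split].
Qed.

(* Weber's first exponential integral. *)
Lemma integral_psi_gaussian (b y : R) : 0 < b ->
  m.-integrable Rpos (EFin \o (fun x => psi nu ((x * y) ^+ 2) * gaussian b x)) /\
  \int[m]_(x in Rpos) (psi nu ((x * y) ^+ 2) * gaussian b x) =
    b `^ (- (nu + 1)) * gaussian b^-1 y.
Proof.
move=> b0; pose c i := psi_coeff nu i * (y ^+ 2) ^+ i.
pose t i x := (c i * moment_fun i b x)%:E.
pose f_ n x := (\sum_(0 <= i < n) t i x)%E.
pose f x := (psi nu ((x * y) ^+ 2) * gaussian b x)%:E.
(* The dominating function: its termwise integrals form the exponential series of [+ y^2 / (2 b)],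
   hence have a finite sum. *)
pose g x := (\sum_(0 <= i <oo) `|t i x|)%E.
have mt i : measurable_fun Rpos (t i).
  by apply/measurable_EFinP; apply: measurable_funM => //; exact: measurable_moment_fun.
have mf_ n : measurable_fun Rpos (f_ n) by apply: emeasurable_sum.
have f_f x : f_ ^~ x @ \oo --> f x.
  rewrite /f_ /f; under eq_fun do rewrite sumEFin.
  apply: cvg_EFin; first by apply: nearW => n.
  rewrite (_ : _ \o _ = pseries (psi_coeff nu) ((x * y) ^+ 2) \* cst (gaussian b x)).
    by apply: cvgM; [exact: cvg_psi_series|exact: cvg_cst].
  apply/funext => n; rewrite /= /pseries /series/= mulr_suml.
  apply: eq_bigr => i _; rewrite /c /moment_fun !exprMn -addnn exprD.
  by ring.
have mf : measurable_fun Rpos f.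
  by apply: (emeasurable_fun_cvg _ _ mf_) => x _; exact: f_f.
have mg : measurable_fun Rpos g.
  by apply: ge0_emeasurable_sum => // i _; apply: measurableT_comp.
have fg x n : (`|f_ n x| <= g x)%E.
  apply: (le_trans (lee_abs_sum _ _ _)).
  by apply: nneseries_lim_ge => i _ _; exact: abse_ge0.
have intt i : (\int[m]_(x in Rpos) t i x =
    (b `^ (- (nu + 1)) * exp_coeff (- (b^-1 / 2 * y ^+ 2)) i)%:E)%E.
  by rewrite integral_moment_fun// psi_coeff_moment.
have intg : (\int[m]_(x in Rpos) g x < +oo)%E.
  rewrite integral_nneseries//; last by move=> i; apply: measurableT_comp.
  rewrite (_ : (fun n => _) = fun n =>
      (series (fun i => b `^ (- (nu + 1)) * exp_coeff (b^-1 / 2 * y ^+ 2) i) n)%:E).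
    have h := @is_cvg_seriesZ _ _ (b `^ (- (nu + 1)))
      (is_cvg_series_exp_coeff (b^-1 / 2 * y ^+ 2)).
    by rewrite EFin_lim// ltry.
  apply/funext => n; rewrite /series/= -sumEFin; apply: eq_bigr => i _.
  transitivity (\int[m]_(x in Rpos) (`|c i| * moment_fun i b x)%:E)%E.
    apply: eq_integral => x _; rewrite /t /= normrM.
    by rewrite (ger0_norm (moment_fun_ge0 _ _ _)).
  rewrite integral_moment_fun//; congr EFin.
  rewrite -[X in _ * X = _]ger0_norm ?mulr_ge0 ?powR_ge0 ?(ltW (M0 _))//.
  rewrite -normrM psi_coeff_moment//.
  rewrite normrM (ger0_norm (powR_ge0 _ _)); congr (_ * _).
  rewrite /exp_coeff/= normrM normrX normrN normfV normr_nat ger0_norm//.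
  by rewrite mulr_ge0 ?sqr_ge0// divr_ge0 ?invr_ge0 ?ltW.
have ig : m.-integrable Rpos g.
  apply/integrableP; split => //.
  under eq_integral => x _.
    rewrite gee0_abs; last by apply: nneseries_ge0 => i _ _; exact: abse_ge0.
    over.
  exact: intg.
have [h1 _ h3] := dominated_convergence (@measurable_Rpos R) mf_ mf
  (aeW _ (fun x _ => f_f x)) ig (aeW _ (fun x n _ => fg x n)).
split; first exact: h1.
suff e : (\int[m]_(x in Rpos) f x = (b `^ (- (nu + 1)) * gaussian b^-1 y)%:E)%E.
  by rewrite /Rintegral -/f e.
apply: (cvg_unique _ h3) => //.
rewrite (_ : (fun n => _) = fun n =>
    (series (fun i => b `^ (- (nu + 1)) * exp_coeff (- (b^-1 / 2 * y ^+ 2)) i) n)%:E).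
  apply: cvg_EFin; first by apply: nearW => n.
  rewrite seriesZ; apply: cvgZl_tmp.
  exact: is_cvg_series_exp_coeff.
apply/funext => n; rewrite integral_sum//; last first.
  by move=> i; exact: integrable_moment_funZ.
by rewrite /series/= -sumEFin; apply: eq_bigr => i _; exact: intt.
Qed.

End weber.

(** * The transform on the span of the Gaussians *)

Section gaussian_span.
Context {R : realType} (nu : R).
Hypothesis nu_gt : - (1 / 2) < nu.
Local Notation m := (bessel_measure nu).
Local Notation M := (moment1 nu).
Implicit Types (s t : seq (R * R)) (u v : R -> R).

(* Finite combinations of Gaussians, coded by the list of pairs
   (coefficient, exponent); [gdual] is the action of the transform. *)
Definition gval s (x : R) : R := \sum_(p <- s) p.1 * gaussian p.2 x.

Definition gpos s : bool := all (fun p => 0 < p.2) s.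

Definition gscale (k : R) s : seq (R * R) := [seq (k * p.1, p.2) | p <- s].

Definition gdual s : seq (R * R) :=
  [seq (p.1 * p.2 `^ (- (nu + 1)), p.2^-1) | p <- s].

(** The real form of [fourier_bessel], with [psi] for [bessel_phi]; the kernels agree for positive
    [x] and [y]. *)
Definition hankel u (y : R) : R :=
  \int[m]_(x in Rpos) (psi nu ((x * y) ^+ 2) * u x).

(** The squared L^2 norm, kept in the extended reals so that estimates can precede finiteness. *)
Definition sqint u : \bar R := (\int[m]_(x in Rpos) (u x ^+ 2)%:E)%E.

Lemma gval_cat s t x : gval (s ++ t) x = gval s x + gval t x.
Proof. exact: big_cat. Qed.

Lemma gval_scale k s x : gval (gscale k s) x = k * gval s x.
Proof.
by rewrite /gval /gscale big_map mulr_sumr; apply: eq_bigr => p _; rewrite mulrA.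
Qed.

Lemma gpos_cat s t : gpos (s ++ t) = gpos s && gpos t.
Proof. exact: all_cat. Qed.

Lemma gpos_scale k s : gpos (gscale k s) = gpos s.
Proof. by rewrite /gpos /gscale all_map; apply: eq_all. Qed.

Lemma gpos_dual s : gpos (gdual s) = gpos s.
Proof. by rewrite /gpos /gdual all_map; apply: eq_all => p /=; rewrite invr_gt0. Qed.

Lemma gdual_cat s t : gdual (s ++ t) = gdual s ++ gdual t.
Proof. exact: map_cat. Qed.

Lemma gdual_scale k s : gdual (gscale k s) = gscale k (gdual s).
Proof. by rewrite /gdual /gscale -!map_comp; apply: eq_map => p /=; rewrite mulrA. Qed.

Let powRV (b c : R) : 0 < b -> b^-1 `^ c = (b `^ c)^-1.
Proof. by move=> b0; rewrite -powR_inv1 ?ltW// -powRrM mulN1r powRN. Qed.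

Lemma gdualK s : gpos s -> gdual (gdual s) = s.
Proof.
move=> /allP s0; rewrite /gdual -map_comp map_id_in// => -[c b] /s0 /= b0.
rewrite invrK powRV// mulfK// gt_eqF// powR_gt0//.
Qed.

Lemma measurable_gval s D : measurable D -> measurable_fun D (gval s).
Proof.
move=> mD; apply: measurable_sum => p.
by apply: measurable_funM => //; exact: measurable_gaussian.
Qed.

Let gaussian_moment_fun (b x : R) : gaussian b x = moment_fun 0 b x.
Proof. by rewrite /moment_fun expr0 mul1r. Qed.

Lemma integrable_gaussian b : 0 < b -> m.-integrable Rpos (EFin \o gaussian b).
Proof.
move=> b0; apply: eq_integrable (integrable_moment_fun nu_gt 0 b0) => //.
by move=> x _ /=; rewrite -gaussian_moment_fun.
Qed.

Lemma Rintegral_gaussian b : 0 < b ->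
  \int[m]_(x in Rpos) gaussian b x = b `^ (- (nu + 1)) * M 0.
Proof.
move=> b0; under eq_Rintegral do rewrite gaussian_moment_fun.
by rewrite /Rintegral -/(moment nu 0 b) moment_scale//= add0r.
Qed.

Let integrable_scaled_gaussian (c b : R) : 0 < b ->
  m.-integrable Rpos (fun x => (c * gaussian b x)%:E).
Proof.
by move=> b0; apply: eq_integrable (integrableZl _ c (integrable_gaussian b0)).
Qed.

Lemma integrable_gval s : gpos s -> m.-integrable Rpos (EFin \o gval s).
Proof.
elim: s => [_|p s ih /= /andP[p0 s0]].
  apply: eq_integrable (integrable0 m Rpos) => // x _.
  by rewrite /= /gval big_nil.
apply: eq_integrable (integrableD _ (integrable_scaled_gaussian p.1 p0) (ih s0)) => //.
by move=> x _; rewrite /= /gval big_cons.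
Qed.

Lemma Rintegral_gval s : gpos s ->
  \int[m]_(x in Rpos) gval s x = \sum_(p <- s) p.1 * (p.2 `^ (- (nu + 1)) * M 0).
Proof.
elim: s => [_|p s ih /= /andP[p0 s0]].
  by rewrite big_nil; under eq_Rintegral do rewrite /gval big_nil;
    rewrite /Rintegral integral0.
rewrite big_cons -ih//.
under [LHS]eq_Rintegral do rewrite /gval big_cons.
rewrite RintegralD//; last 2 first.
- exact: (integrable_scaled_gaussian p.1 p0).
- exact: (integrable_gval s0).
by rewrite RintegralZl//; [rewrite Rintegral_gaussian|exact: integrable_gaussian].
Qed.

Definition gmul s t : seq (R * R) :=
  [seq (p.1 * r.1, p.2 + r.2) | p <- s, r <- t].

Lemma gval_mul s t x : gval (gmul s t) x = gval s x * gval t x.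
Proof.
rewrite /gval /gmul big_allpairs_dep /= mulr_suml; apply: eq_bigr => p _.
rewrite mulr_sumr; apply: eq_bigr => r _.
rewrite (_ : gaussian (p.2 + r.2) x = gaussian p.2 x * gaussian r.2 x); last first.
  by rewrite /gaussian -expRD; congr expR; rewrite !mulrDl opprD.
by ring.
Qed.

Lemma gpos_mul s t : gpos s -> gpos t -> gpos (gmul s t).
Proof.
move=> /allP s0 /allP t0; apply/allP => _ /allpairsP[[p r] /= [ps rt ->]] /=.
by apply: addr_gt0; [exact: (s0 p)|exact: (t0 r)].
Qed.

Lemma sqint_gval s : gpos s ->
  sqint (gval s) = (\sum_(p <- s) \sum_(r <- s)
    p.1 * r.1 * ((p.2 + r.2) `^ (- (nu + 1)) * M 0))%:E.
Proof.
move=> s0; have ss0 := gpos_mul s0 s0.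
transitivity ((\int[m]_(x in Rpos) gval (gmul s s) x)%:E).
  rewrite /Rintegral fineK; last first.
    by apply: integrable_fin_num => //; exact: (integrable_gval ss0).
  by apply: eq_integral => x _; rewrite gval_mul expr2.
rewrite Rintegral_gval//; congr EFin.
by rewrite /gmul big_allpairs_dep.
Qed.

Lemma sqint_gdual s : gpos s -> sqint (gval (gdual s)) = sqint (gval s).
Proof.
move=> s0; rewrite !sqint_gval ?gpos_dual//; congr EFin.
have /allP h := s0.
rewrite /gdual big_map big_seq [RHS]big_seq; apply: eq_bigr => p ps.
rewrite big_map big_seq [RHS]big_seq; apply: eq_bigr => r rs /=.
have p0 : 0 < p.2 by exact: h.
have r0 : 0 < r.2 by exact: h.
have -> : p.2 + r.2 = p.2 * (r.2 * (p.2^-1 + r.2^-1)).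
  by field; rewrite !gt_eqF.
have d0 : 0 <= p.2^-1 + r.2^-1 by rewrite addr_ge0// invr_ge0 ltW.
by rewrite !powRM ?mulr_ge0 ?(ltW p0) ?(ltW r0)//; ring.
Qed.

Lemma hankel_gval s y : gpos s ->
  m.-integrable Rpos (EFin \o (fun x => psi nu ((x * y) ^+ 2) * gval s x)) /\
  hankel (gval s) y = gval (gdual s) y.
Proof.
rewrite /hankel; elim: s => [_|p s ih /= /andP[p0 s0]].
  split.
    apply: eq_integrable (integrable0 m Rpos) => // x _.
    by rewrite /= /gval big_nil mulr0.
  rewrite /gval big_nil; under eq_Rintegral do rewrite big_nil mulr0.
  by rewrite /Rintegral integral0.
have [i1 e1] := ih s0; have [i2 e2] := integral_psi_gaussian nu_gt y p0.
have i3 : m.-integrable Rpos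
    (EFin \o (fun x => p.1 * (psi nu ((x * y) ^+ 2) * gaussian p.2 x))).
  by apply: eq_integrable (integrableZl _ p.1 i2).
have E x : psi nu ((x * y) ^+ 2) * gval (p :: s) x =
    p.1 * (psi nu ((x * y) ^+ 2) * gaussian p.2 x) + psi nu ((x * y) ^+ 2) * gval s x.
  by rewrite /gval big_cons; ring.
split.
  by apply: eq_integrable (integrableD _ i3 i1) => // x _; rewrite /= E.
under eq_Rintegral do rewrite E.
rewrite RintegralD// RintegralZl// e1 e2 /gval big_cons /=.
by rewrite -mulrA.
Qed.

End gaussian_span.

(** * Density of the span of the Gaussians *)

Section gaussian_closure.
Context {R : realType} (nu : R).
Hypothesis nu_gt : - (1 / 2) < nu.
Local Notation m := (bessel_measure nu).
Implicit Types (s t : seq (R * R)) (u v : R -> R).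

(* Finite exactly on the intersection of L^1 and L^2, and it controls both
   norms at once. *)
Definition l12 u : \bar R := (\int[m]_(x in Rpos) (`|u x| + u x ^+ 2)%:E)%E.

Let l12_fun_ge0 u x : 0 <= `|u x| + u x ^+ 2.
Proof. by rewrite addr_ge0// sqr_ge0. Qed.

Lemma l12_ge0 u : (0 <= l12 u)%E.
Proof. by apply: integral_ge0 => x _; rewrite lee_fin. Qed.

Lemma measurable_l12_fun u : measurable_fun Rpos u ->
  measurable_fun Rpos (fun x => (`|u x| + u x ^+ 2)%:E).
Proof.
move=> mu; apply/measurable_EFinP; apply: measurable_funD.
  exact: measurableT_comp.
exact: measurable_funX.
Qed.

Lemma eq_l12 u v : (forall x, Rpos x -> u x = v x) -> l12 u = l12 v.
Proof. by move=> uv; apply: eq_integral => x /set_mem/uv ->. Qed.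

Lemma le_l12 u v : measurable_fun Rpos u -> measurable_fun Rpos v ->
  (forall x, Rpos x -> `|u x| <= `|v x|) -> (l12 u <= l12 v)%E.
Proof.
move=> mu mv uv; apply: ge0_le_integral => //.
- by move=> x _; rewrite lee_fin.
- exact: measurable_l12_fun.
- exact: measurable_l12_fun.
- move=> x Rx; rewrite lee_fin lerD ?uv//.
  by rewrite -real_normK ?num_real// -[leRHS]real_normK ?num_real// ler_sqr ?nnegrE ?uv.
Qed.

Lemma l12D u v : measurable_fun Rpos u -> measurable_fun Rpos v ->
  (l12 (u \+ v)%R <= 2%:E * l12 u + 2%:E * l12 v)%E.
Proof.
move=> mu mv; rewrite /l12 -!ge0_integralZl//; last 4 first.
- exact: measurable_l12_fun.
- by move=> x _; rewrite lee_fin.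
- exact: measurable_l12_fun.
- by move=> x _; rewrite lee_fin.
rewrite -ge0_integralD//; last 4 first.
- by move=> x _; rewrite -EFinM lee_fin mulr_ge0.
- by apply: emeasurable_funM => //; exact: measurable_l12_fun.
- by move=> x _; rewrite -EFinM lee_fin mulr_ge0.
- by apply: emeasurable_funM => //; exact: measurable_l12_fun.
apply: ge0_le_integral => //.
- by move=> x _; rewrite lee_fin (l12_fun_ge0 (u \+ v)).
- by apply: (@measurable_l12_fun (u \+ v)); exact: measurable_funD.
- apply: emeasurable_funD; apply: emeasurable_funM => //; exact: measurable_l12_fun.
- move=> x _; rewrite -!EFinM -EFinD lee_fin /=.
  have := ler_normD (u x) (v x); have := normr_ge0 (u x); have := normr_ge0 (v x).
  by have := sqr_ge0 (u x - v x); nra.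
Qed.

(** [l12] is not homogeneous: its two terms scale by [|k|] and by [k^2], and the factor bounds
    both. *)
Lemma l12Z k u : measurable_fun Rpos u ->
  (l12 (fun x => k * u x)%R <= (`|k| + k ^+ 2)%:E * l12 u)%E.
Proof.
move=> mu; rewrite /l12 -ge0_integralZl//; last 3 first.
- exact: measurable_l12_fun.
- by move=> x _; rewrite lee_fin.
- by rewrite lee_fin addr_ge0// sqr_ge0.
apply: ge0_le_integral => //.
- by move=> x _; rewrite lee_fin (l12_fun_ge0 (fun x => k * u x)).
- by apply: (@measurable_l12_fun (fun x => k * u x)); exact: measurable_funM.
- by apply: emeasurable_funM => //; exact: measurable_l12_fun.
- move=> x _; rewrite -EFinM lee_fin normrM exprMn.
  have := normr_ge0 (u x); have := normr_ge0 k.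
  have := sqr_ge0 (u x); have := sqr_ge0 k; nra.
Qed.

Lemma l12_lty_Z k u : measurable_fun Rpos u ->
  (l12 u < +oo)%E -> (l12 (fun x => k * u x)%R < +oo)%E.
Proof.
move=> mu u0; apply: (le_lt_trans (l12Z k mu)).
by rewrite lte_mul_pinfty// lee_fin addr_ge0// sqr_ge0.
Qed.

Lemma l12_gval_lty s : gpos s -> (l12 (gval s) < +oo)%E.
Proof.
move=> s0; rewrite /l12; under eq_integral do rewrite EFinD.
rewrite ge0_integralD//; last 3 first.
- by apply/measurable_EFinP/measurableT_comp => //; exact: measurable_gval.
- by move=> x _; rewrite lee_fin sqr_ge0.
- by apply/measurable_EFinP/measurable_funX; exact: measurable_gval.
rewrite lte_add_pinfty//.
  by have /integrableP[_] := integrable_gval nu_gt s0.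
by rewrite -/(sqint nu (gval s)) sqint_gval// ltry.
Qed.

Lemma l12_dominated_cvg (u_ : (R -> R)^nat) u v :
  (forall n, measurable_fun Rpos (u_ n)) -> measurable_fun Rpos u ->
  measurable_fun Rpos v -> (l12 v < +oo)%E ->
  (forall n x, Rpos x -> `|u_ n x| <= v x) ->
  {ae m, forall x, Rpos x -> u_ ^~ x @ \oo --> u x} ->
  l12 (u \- u_ n)%R @[n --> \oo] --> 0%E.
Proof.
move=> mu_ mu mv v0 u_v u_u.
have v2 : (l12 (fun x => 2 * v x)%R < +oo)%E by exact: l12_lty_Z.
(* The bound [v] passes from [u_ n] to [u] wherever there is convergence, hence [|u - u_ n| <= 2 v]
   almost everywhere. *)
pose g (x : R) : \bar R := (`|2 * v x| + (2 * v x) ^+ 2)%:E.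
have ig : m.-integrable Rpos g.
  apply/integrableP; split.
    by apply: (@measurable_l12_fun (fun x => 2 * v x)); exact: measurable_funM.
  under eq_integral do rewrite gee0_abs ?lee_fin ?(l12_fun_ge0 (fun x => 2 * v x))//.
  exact: v2.
pose f_ n (x : R) : \bar R := (`|u x - u_ n x| + (u x - u_ n x) ^+ 2)%:E.
have mf_ n : measurable_fun Rpos (f_ n).
  by apply: (@measurable_l12_fun (u \- u_ n)); exact: measurable_funB.
have f_0 : {ae m, forall x, Rpos x -> f_ ^~ x @ \oo --> 0%E}.
  apply: filterS u_u => x /[apply] ux.
  apply: cvg_EFin; first exact: nearW.
  have d0 : (u x - u_ n x) @[n --> \oo] --> (0 : R).
    by rewrite -[X in _ --> X](subrr (u x)); apply: cvgB => //; exact: cvg_cst.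
  rewrite -[X in _ --> X](addr0 0); apply: cvgD.
    by rewrite -[X in _ --> X](normr0 R); exact: cvg_norm.
  rewrite -[X in _ --> X](mulr0 0).
  under eq_cvg do rewrite /= expr2; exact: cvgM.
have f_g : {ae m, forall x n, Rpos x -> (`|f_ n x| <= g x)%E}.
  apply: filterS u_u => x u_ux n Rx.
  have {u_ux} ux := u_ux Rx.
  have uv : `|u x| <= v x.
    have nux : `|u_ k x| @[k --> \oo] --> `|u x| by exact: cvg_norm.
    rewrite -(cvg_lim _ nux)//; apply: limr_le; first exact: cvgP nux.
    by apply: nearW => k; exact: u_v.
  rewrite gee0_abs ?lee_fin ?(l12_fun_ge0 (u \- u_ n))// /f_ /g.
  have h : `|u x - u_ n x| <= 2 * v x.
    by rewrite (le_trans (ler_normB _ _))// mulr2n mulrDl mul1r lerD// u_v.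
  have h' : 2 * v x <= `|2 * v x| by exact: ler_norm.
  rewrite lerD ?(le_trans h)//.
  rewrite -real_normK ?num_real// -[leRHS]real_normK ?num_real//.
  by rewrite ler_sqr ?nnegrE// (le_trans h).
have [_ _] := dominated_convergence (@measurable_Rpos R) mf_
  (@measurable_cst _ _ _ _ _ 0%E) f_0 ig f_g.
by rewrite integral0.
Qed.

Definition gapprox u : Prop := measurable_fun Rpos u /\
  forall e : R, 0 < e -> exists2 s, gpos s & (l12 (u \- gval s)%R <= e%:E)%E.

Lemma gapprox_measurable u : gapprox u -> measurable_fun Rpos u.
Proof. by case. Qed.

Let measurable_subgval u s : measurable_fun Rpos u ->
  measurable_fun Rpos (u \- gval s).
Proof. by move=> mu; apply: measurable_funB => //; exact: measurable_gval. Qed.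

Lemma gapprox_closed u : measurable_fun Rpos u ->
  (forall e : R, 0 < e -> exists2 v, gapprox v & (l12 (u \- v)%R <= e%:E)%E) ->
  gapprox u.
Proof.
move=> mu H; split => // e e0.
(* Quarters, to offset the two factors 2 of [l12D]. *)
have [v [mv av] uv] := H (e / 4) (divr_gt0 e0 (ltr0Sn R 3)).
have [s s0 vs] := av (e / 4) (divr_gt0 e0 (ltr0Sn R 3)).
exists s => //.
rewrite (_ : u \- gval s = (u \- v) \+ (v \- gval s)); last first.
  by apply/funext => x /=; rewrite addrA subrK.
apply: (le_trans (l12D (measurable_funB mu mv) (measurable_subgval _ mv))).
rewrite (_ : e%:E = 2%:E * (e / 4)%:E + 2%:E * (e / 4)%:E)%E; last first.
  by rewrite -!EFinM -EFinD; congr EFin; field.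
by apply: leeD; rewrite lee_wpmul2l// lee_fin.
Qed.

Lemma gapprox_cvg (u_ : (R -> R)^nat) u :
  (forall n, gapprox (u_ n)) -> measurable_fun Rpos u ->
  l12 (u \- u_ n)%R @[n --> \oo] --> 0%E -> gapprox u.
Proof.
move=> au_ mu u_u; apply: gapprox_closed => // e e0.
have : \forall n \near \oo, (l12 (u \- u_ n)%R < e%:E)%E.
  by apply: (u_u [set y | (y < e%:E)%E]); exact: nbhs_open_ereal_lt.
by move=> [N _ /(_ N (leqnn N)) /ltW h]; exists (u_ N).
Qed.

Lemma gapprox_dominated (u_ : (R -> R)^nat) u v :
  (forall n, gapprox (u_ n)) -> measurable_fun Rpos u ->
  measurable_fun Rpos v -> (l12 v < +oo)%E ->
  (forall n x, Rpos x -> `|u_ n x| <= v x) ->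
  {ae m, forall x, Rpos x -> u_ ^~ x @ \oo --> u x} -> gapprox u.
Proof.
move=> au_ mu mv v0 u_v u_u; apply: (gapprox_cvg au_) => //.
by apply: (@l12_dominated_cvg u_ u v) => // n; exact: gapprox_measurable.
Qed.

Lemma gapprox_gval s : gpos s -> gapprox (gval s).
Proof.
move=> s0; split => [|e e0]; first exact: measurable_gval.
exists s => //; rewrite (_ : _ \- _ = cst 0); last by apply/funext => x /=; rewrite subrr.
by rewrite /l12; under eq_integral do rewrite /= normr0 expr0n addr0;
  rewrite integral0 lee_fin ltW.
Qed.

Lemma gapproxD u v : gapprox u -> gapprox v -> gapprox (u \+ v).
Proof.
move=> [mu au] [mv av]; split => [|e e0]; first exact: measurable_funD.
have [s s0 us] := au (e / 4) (divr_gt0 e0 (ltr0Sn R 3)).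
have [t t0 vt] := av (e / 4) (divr_gt0 e0 (ltr0Sn R 3)).
exists (s ++ t); first by rewrite gpos_cat s0.
rewrite (_ : _ \- _ = (u \- gval s) \+ (v \- gval t)); last first.
  by apply/funext => x /=; rewrite gval_cat opprD addrACA.
apply: (le_trans (l12D (measurable_subgval _ mu) (measurable_subgval _ mv))).
rewrite (_ : e%:E = 2%:E * (e / 4)%:E + 2%:E * (e / 4)%:E)%E; last first.
  by rewrite -!EFinM -EFinD; congr EFin; field.
by apply: leeD; rewrite lee_wpmul2l// lee_fin.
Qed.

Lemma gapproxZ k u : gapprox u -> gapprox (fun x => k * u x).
Proof.
move=> [mu au]; split => [|e e0]; first exact: measurable_funM.
(* The added 1 keeps the divisor positive when [k = 0]. *)
have c0 : 0 < `|k| + k ^+ 2 + 1 by rewrite ltr_wpDl// addr_ge0// sqr_ge0.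
have [s s0 us] := au (e / (`|k| + k ^+ 2 + 1)) (divr_gt0 e0 c0).
exists (gscale k s); first by rewrite gpos_scale.
rewrite (_ : _ \- _ = (fun x => k * (u \- gval s) x)); last first.
  by apply/funext => x /=; rewrite gval_scale mulrBr.
apply: (le_trans (l12Z k (measurable_subgval _ mu))).
apply: (@le_trans _ _ ((`|k| + k ^+ 2 + 1)%:E * (e / (`|k| + k ^+ 2 + 1))%:E)%E).
  apply: lee_pmul => //; rewrite ?l12_ge0// lee_fin; last by rewrite lerDl.
  by rewrite addr_ge0// sqr_ge0.
by rewrite -EFinM lee_fin mulrC divfK// gt_eqF.
Qed.

Lemma gapprox0 : gapprox (cst 0).
Proof.
have := @gapprox_gval [::] isT; congr gapprox.
by apply/funext => x; rewrite /gval big_nil.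
Qed.

Lemma gapprox_sum (I : Type) (r : seq I) (F : I -> R -> R) :
  (forall i, gapprox (F i)) -> gapprox (fun x => \sum_(i <- r) F i x).
Proof.
move=> aF; elim: r => [|i r ih].
  by under eq_fun do rewrite big_nil; exact: gapprox0.
by under eq_fun do rewrite big_cons; exact: gapproxD.
Qed.

Lemma eq_gapprox u v : (forall x, Rpos x -> u x = v x) -> gapprox u -> gapprox v.
Proof.
move=> uv [mu au]; split.
  by apply: eq_measurable_fun mu => x /set_mem/uv.
move=> e /au[s s0 us]; exists s => //.
by rewrite -(@eq_l12 (u \- gval s)%R)// => x Rx /=; rewrite uv.
Qed.

End gaussian_closure.

(** * Indicator functions as limits of Gaussian combinations *)

Section gaussian_density.
Context {R : realType} (nu : R).
Hypothesis nu_gt : - (1 / 2) < nu.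
Local Notation m := (bessel_measure nu).
Local Notation gapprox := (@gapprox R nu).
Local Notation l12 := (@l12 R nu).
Implicit Types (s t : seq (R * R)) (u v : R -> R).

(** With [w] the Gaussian of parameter [b], this codes [S_k = 1 - (1 - w)^k] through
    [S_(k+1) = S_k + w - w S_k]. The recursion stays within positive parameters, whereas the
    constant 1 lies outside the span. *)
Fixpoint gstep (b : R) (k : nat) : seq (R * R) :=
  if k is k'.+1 then
    gstep b k' ++ (1, b) :: gscale (-1) (gmul [:: (1, b)] (gstep b k'))
  else [::].

Lemma gval_step b k x : gval (gstep b k) x = 1 - (1 - gaussian b x) ^+ k.
Proof.
elim: k => [|k ih]; first by rewrite /gval big_nil expr0 subrr.
rewrite /= gval_cat -cat1s gval_cat gval_scale gval_mul ih.
by rewrite /gval big_seq1/= exprS; ring.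
Qed.

Lemma gpos_step b k : 0 < b -> gpos (gstep b k).
Proof.
move=> b0; have b1 : gpos [:: (1, b)] by rewrite /gpos/= b0.
elim: k => // k ih; rewrite /= gpos_cat ih -cat1s gpos_cat b1/=.
by rewrite gpos_scale gpos_mul.
Qed.

Let gaussian_le1 (b x : R) : 0 < b -> gaussian b x <= 1.
Proof.
move=> b0; rewrite /gaussian -expR0 ler_expR oppr_le0 mulr_ge0 ?sqr_ge0//.
by rewrite divr_ge0// ltW.
Qed.

Let gaussianX (b x : R) n : gaussian (n%:R * b) x = gaussian b x ^+ n.
Proof.
rewrite /gaussian -expRM_natl; congr expR.
by rewrite -mulr_natl; field.
Qed.

Let step_ge0 (w : R) k : 0 <= w <= 1 -> 0 <= 1 - (1 - w) ^+ k.
Proof.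
move=> /andP[w0 w1]; rewrite subr_ge0 exprn_ile1 ?subr_ge0//.
by rewrite gerBl.
Qed.

Let step_le1 (w : R) k : 0 <= w <= 1 -> 1 - (1 - w) ^+ k <= 1.
Proof. by move=> /andP[w0 w1]; rewrite gerBl exprn_ge0// subr_ge0. Qed.

(** The estimate for the region [2 z < 1]: with [w = z^n] and [k = 2^n] the bound is [(2 z)^n]. *)
Let step_leM (w : R) k : 0 <= w <= 1 -> 1 - (1 - w) ^+ k <= k%:R * w.
Proof.
move=> w01; elim: k => [|k ih]; first by rewrite expr0 subrr mul0r.
have h := step_ge0 k w01; move: w01 ih => /andP[w0 w1].
rewrite exprS -natr1 mulrDl mul1r => ih.
have := mulr_ge0 w0 h; move: ih h.
by move: ((1 - w) ^+ k) (k%:R : R) => p K; nra.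
Qed.

(** The estimate for the region [2 z > 1]: with [w = z^n] and [k = 2^n] it puts [1 - (1 - w)^k]
    within [1 / (1 + (2 z)^n)] of 1. Both factors are compared with exponentials of opposite
    exponents. *)
Let step_ge (w : R) k : 0 <= w <= 1 -> (1 - w) ^+ k * (1 + k%:R * w) <= 1.
Proof.
move=> /andP[w0 w1]; rewrite (@le_trans _ _ (expR (- w) ^+ k * expR (k%:R * w)))//.
  rewrite ler_pM ?exprn_ge0 ?subr_ge0 ?addr_ge0 ?mulr_ge0//.
    by rewrite lerXn2r ?nnegrE ?subr_ge0 ?expR_ge0// expR_ge1Dx.
  exact: expR_ge1Dx.
by rewrite -expRM_natl -expRD mulrN addNr expR0.
Qed.

Let cvg_inv_geom (z : R) : 1 < z -> (1 + z ^+ n)^-1 @[n --> \oo] --> (0 : R).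
Proof.
move=> z1; have z0 : 0 < z by rewrite (lt_trans _ z1).
have h : (z^-1 ^+ n) @[n --> \oo] --> (0 : R).
  by apply: cvg_expr; rewrite ger0_norm ?invr_ge0 ?ltW// invf_lt1.
apply: (@squeeze_cvgr _ _ _ _ (fun=> 0) (fun n => z^-1 ^+ n)) => //.
  apply: nearW => n; have zn : 0 < z ^+ n by rewrite exprn_gt0.
  rewrite invr_ge0 addr_ge0 ?(ltW zn)//= exprVn lef_pV2 ?posrE//.
    by rewrite lerDr.
  by rewrite addr_gt0.
exact: cvg_cst.
Qed.

Let negligible_set1 (c : R) : m [set c] = 0%E.
Proof. by rewrite /= /bessel_measure integral_set1. Qed.

Lemma gapprox_ray c : 0 < c ->
  gapprox (\1_(`]-oo, c[)) /\ (l12 (\1_(`]-oo, c[)) < +oo)%E.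
Proof.
(* With this [b] the Gaussian takes the value 1/2 at [c], so [2 * z x] crosses 1 exactly there. *)
move=> c0; pose b := 2 * ln 2 / c ^+ 2.
have l0 : 0 < ln 2 :> R by rewrite ln_gt0// ltr1n.
have c20 : 0 < c ^+ 2 by rewrite exprn_gt0.
have b0 : 0 < b by rewrite divr_gt0// mulr_gt0.
pose z := gaussian b.
have zE x : z x = expR (- (ln 2 * (x ^+ 2 / c ^+ 2))).
  rewrite /z /gaussian /b; congr expR; field.
  by rewrite gt_eqF.
have z2 : 2 = expR (ln 2) :> R by rewrite lnK// posrE.
have zlt x : 0 < x -> x < c -> 1 < 2 * z x.
  move=> x0 xc; rewrite zE {1}z2 -expRD expR_gt1 subr_gt0 gtr_pMr//.
  by rewrite ltr_pdivrMr// mul1r ltr_pXn2r// nnegrE ltW.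
have zgt x : c < x -> 2 * z x < 1.
  move=> xc; rewrite zE {1}z2 -expRD expR_lt1 subr_lt0 ltr_pMr//.
  by rewrite ltr_pdivlMr// mul1r ltr_pXn2r// nnegrE ltW// (lt_trans c0).
have z0 x : 0 < z x by exact: gaussian_gt0.
have z1 x : z x <= 1 by exact: gaussian_le1.
(* The power [z^(n+1)] is the Gaussian of parameter [(n + 1) b]; the shift of the index keeps this
   parameter positive. *)
pose s n := gstep (n.+1%:R * b) (2 ^ n.+1).
have s0 n : gpos (s n) by apply: gpos_step; rewrite mulr_gt0.
have sE n x : gval (s n) x = 1 - (1 - z x ^+ n.+1) ^+ (2 ^ n.+1).
  by rewrite gval_step gaussianX.
have zn01 n x : 0 <= z x ^+ n <= 1.
  by rewrite exprn_ge0 ?(ltW (z0 _))//= exprn_ile1// ltW.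
have sz n x : gval (s n) x <= (2 * z x) ^+ n.+1.
  by rewrite sE (le_trans (step_leM _ (zn01 _ _)))// natrX exprMn.
have mind : measurable_fun Rpos (\1_(`]-oo, c[) : R -> R).
  exact: measurable_indic.
(* This dominates the whole sequence: where [2 z <= 1] the terms are at most [(2 z)^(n+1) <= 2 z],
   elsewhere at most [1 < 2 z]. *)
pose v x := 2 * z x.
have mv : measurable_fun Rpos v.
  by apply: measurable_funM => //; exact: measurable_gaussian.
have v0 : (l12 v < +oo)%E.
  rewrite (_ : v = gval [:: (2, b)]); last first.
    by apply/funext => x; rewrite /gval big_seq1.
  by apply: l12_gval_lty => //; rewrite /gpos/= b0.
split.
  apply: (@gapprox_dominated _ _ (fun n => gval (s n)) _ v) => //.
  - by move=> n; exact: gapprox_gval.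
  - move=> n x Rx; rewrite ger0_norm; last by rewrite sE step_ge0.
    have [h|h] := leP (2 * z x) 1.
      rewrite (le_trans (sz _ _))// exprS ler_piMr//.
        by rewrite mulr_ge0// ltW.
      by rewrite exprn_ile1// mulr_ge0// ltW.
    by rewrite (le_trans _ (ltW h))// sE step_le1.
  (* At [c] itself the values tend to [1 - 1/e] and not to the indicator, so convergence holds only
     off a null set. *)
  - exists [set c]; split => //.
    move=> x /=; apply: contra_notP => /eqP xc /Rpos_gt0 x0.
    have [xltc|cltx|] := ltgtP x c; last by move/eqP: xc.
    + rewrite indicE mem_set/=; last by rewrite in_itv.
      have h := cvg_inv_geom (zlt _ x0 xltc).
      rewrite -[X in _ --> X](subr0 1).
      apply: (@squeeze_cvgr _ _ _ _ (fun n => 1 - (1 + (2 * z x) ^+ n.+1)^-1)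
        (fun=> 1)).
      * apply: nearW => n; rewrite sE step_le1// andbT lerD2l lerN2.
        have p0 : 0 < 1 + (2 * z x) ^+ n.+1.
          by rewrite addr_gt0// exprn_gt0// mulr_gt0.
        rewrite -[leRHS]mul1r ler_pdivlMr//.
        have := @step_ge _ (2 ^ n.+1) (zn01 n.+1 x).
        by rewrite natrX -exprMn.
      * apply: cvgB; first exact: cvg_cst.
        by rewrite (cvg_shiftS (fun n => (1 + (2 * z x) ^+ n)^-1)).
      * by rewrite subr0; exact: cvg_cst.
    + rewrite indicE memNset/=; last first.
        by rewrite in_itv/=; apply/negP; rewrite -leNgt ltW.
      apply: (@squeeze_cvgr _ _ _ _ (fun=> 0) (fun n => (2 * z x) ^+ n.+1)).
      * by apply: nearW => n; rewrite sz andbT sE step_ge0.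
      * exact: cvg_cst.
      * rewrite (cvg_shiftS (fun n => (2 * z x) ^+ n)); apply: cvg_expr.
        by rewrite ger0_norm ?zgt// mulr_ge0// ltW.
apply: le_lt_trans v0; apply: le_l12 => // x /Rpos_gt0 x0.
rewrite indicE; have [xc|xc] := boolP (x \in _); last first.
  by rewrite normr0.
rewrite normr1 ger0_norm; last by rewrite mulr_ge0// ltW.
by move: xc; rewrite inE/= in_itv/= => xc; rewrite ltW// zlt.
Qed.

(** All sets are cut by one fixed ray [I]: its indicator has finite [l12] and dominates the partial
    sums arising from a countable disjoint union. *)
Lemma gapprox_indic_bounded (c : R) A : 0 < c -> measurable A ->
  gapprox (\1_(A `&` `]-oo, c[)).
Proof.
move=> c0 mA; pose I : set R := `]-oo, c[%classic.
have mI : measurable I by exact: measurable_itv.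
have [aI lI] := gapprox_ray c0.
have mind B : measurable B -> measurable_fun Rpos (\1_(B `&` I) : R -> R).
  by move=> mB; apply: measurable_indic; exact: measurableI.
suff H S : <<s @RGenInftyO.G R >> S -> gapprox (\1_(S `&` I)).
  have : (@RGenInftyO.G R).-sigma.-measurable A by rewrite -RGenInftyO.measurableE.
  exact: H.
move: S; apply: dynkin_induction.
- exact: RGenInftyO.measurableE.
- move=> _ _ [x ->] [y ->]; exists (Num.min x y).
  by apply/seteqP; split => t/=; rewrite !in_itv/= lt_min => /andP.
- by rewrite setTI.
- move=> _ [x ->]; have [xc|cx] := leP c x.
    rewrite (_ : _ `&` _ = I)//; apply/seteqP; split => [t []//|t It]; split => //.
    by move: It; rewrite /I/= !in_itv/= => /lt_le_trans; apply.
  have -> : `]-oo, x[%classic `&` I = `]-oo, x[%classic.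
    apply/seteqP; split => [t []//|t It]; split => //.
    by move: It; rewrite /I/= !in_itv/= => /lt_trans; apply.
  have [x0|x0] := leP x 0; last by have [] := gapprox_ray x0.
  apply: (eq_gapprox _ (gapprox0 nu)) => t /Rpos_gt0 t0.
  rewrite indicE memNset//= in_itv/=; apply/negP; rewrite -leNgt.
  by rewrite (le_trans x0)// ltW.
- move=> S mS aS.
  have : gapprox (\1_I \+ (fun x => -1 * \1_(S `&` I) x)).
    by apply: gapproxD => //; exact: gapproxZ.
  congr gapprox; apply/funext => x /=; rewrite !indicE !in_setI in_setC.
  by case: (x \in S); case: (x \in I); rewrite ?mulr1 ?mulr0 ?subrr ?addr0.
- move=> F mF tF aF.
  pose u n x := \sum_(0 <= k < n) \1_(F k `&` I) x : R.
  have u_I k0 x n : F k0 x -> u n x = (k0 < n)%N%:R * (x \in I)%:R.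
    move=> Fk0; rewrite /u; elim: n => [|n ih]; first by rewrite big_nil mul0r.
    rewrite big_nat_recr//= ih indicE in_setI.
    have [->|nk] := eqVneq n k0.
      by rewrite mem_set//= ltnn ltnSn mul0r add0r mul1r.
    rewrite memNset/=; last first.
      move=> Fn; move/eqP: nk; apply.
      by apply: (tF n k0) => //; exists x.
    by rewrite addr0 ltnS [in RHS]leq_eqVlt eq_sym (negbTE nk).
  have u_0 x n : ~ (\bigcup_k F k) x -> u n x = 0.
    move=> Fx; rewrite /u big1// => k _; rewrite indicE memNset//= => -[Fkx _].
    by apply: Fx; exists k.
  apply: (@gapprox_dominated _ _ u _ (\1_I)) => //.
  + by move=> n; exact: gapprox_sum.
  + by apply: mind; exact: bigcup_measurable.
  + move=> n x _; have [[k _ Fkx]|nFx] := pselect ((\bigcup_k F k) x).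
      rewrite (u_I k)// indicE.
      by case: (k < n)%N; case: (x \in I); rewrite ?mul1r ?mul0r ?normr0 ?normr1.
    by rewrite u_0// normr0 indicE.
  + apply: aeW => x _; have [[k _ Fkx]|nFx] := pselect ((\bigcup_k F k) x).
      apply: cvg_near_cst; exists k.+1 => // n /= kn.
      rewrite (u_I k)// kn mul1r !indicE in_setI.
      by rewrite (mem_set (_ : (\bigcup_k F k) x))//; exists k.
    rewrite (_ : u ^~ x = cst 0); last by apply/funext => n; exact: u_0.
    by rewrite indicE in_setI memNset//=; exact: cvg_cst.
Qed.

Import HBNNSimple.

Lemma indic_ray_cvg (x y : R) : (y * \1_(`]-oo, n.+1%:R[) x) @[n --> \oo] --> y.
Proof.
apply: cvg_near_cst; exists (Num.truncn `|x|) => // n /= xn.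
rewrite indicE mem_set ?mulr1//= in_itv/= (le_lt_trans (ler_norm x))//.
by rewrite -truncn_lt_nat// ltnS.
Qed.

Lemma gapprox_ge0 u : measurable_fun Rpos u -> (l12 u < +oo)%E ->
  (forall x, Rpos x -> 0 <= u x) -> gapprox u.
Proof.
move=> mu lu u0.
have mEu : measurable_fun Rpos (EFin \o u) by exact/measurable_EFinP.
pose h := nnsfun_approx (@measurable_Rpos R) mEu.
have h_u x : Rpos x -> h ^~ x @ \oo --> u x.
  move=> Rx; have := @cvg_nnsfun_approx _ _ _ _ (@measurable_Rpos R) _ mEu _ x Rx.
  move=> H; have {}H : (EFin \o h ^~ x) @ \oo --> (u x)%:E.
    by apply: H => y Ry; rewrite lee_fin u0.
  exact: (fine_cvg H).
have h_le n x : Rpos x -> h n x <= u x.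
  move=> Rx; rewrite -(cvg_lim (@Rhausdorff R) (h_u x Rx)).
  apply: nondecreasing_cvgn_le; last by apply/cvg_ex; exists (u x); exact: h_u.
  by move=> p q pq; exact/lefP/nd_nnsfun_approx.
(* The cut at [n + 1] makes the level sets bounded, so that their indicators are known to be limits;
   [u] dominates because [h n] stays below it. *)
pose u_ n x := h n x * \1_(`]-oo, n.+1%:R[) x.
apply: (@gapprox_dominated _ _ u_ _ u) => //.
- move=> n.
  have -> : u_ n = (fun x => \sum_(y <- finmap.enum_fset (fset_set (range (h n))))
      y * \1_((h n @^-1` [set y]) `&` `]-oo, n.+1%:R[) x).
    apply/funext => x; rewrite /u_ fimfunE fsbig_finite//= mulr_suml.
    by apply: eq_bigr => y _; rewrite indicI mulrA.
  by apply: gapprox_sum => y; apply: gapproxZ; exact: gapprox_indic_bounded.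
- move=> n x Rx; rewrite /u_ normrM (ger0_norm (fun_ge0 _)) indicE.
  by case: (x \in _); rewrite ?normr1 ?normr0 ?mulr1 ?mulr0 ?h_le ?u0.
- apply: aeW => x Rx; rewrite -[X in _ --> X]mulr1; apply: cvgM; first exact: h_u.
  by have := @indic_ray_cvg x 1; under eq_fun do rewrite mul1r.
Qed.

Lemma gapprox_l12 u : measurable_fun Rpos u -> (l12 u < +oo)%E -> gapprox u.
Proof.
move=> mu lu.
have mn : measurable_fun Rpos (fun x => `|u x|) by exact: measurableT_comp.
(* The positive part of [u] for [e = 1], its negative part for [e = -1]. *)
have H (e : R) : `|e| = 1 -> gapprox (fun x => 2^-1 * (`|u x| + e * u x)).
  move=> e1; have me : measurable_fun Rpos (fun x => 2^-1 * (`|u x| + e * u x)).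
    by apply: measurable_funM => //; apply: measurable_funD => //; exact: measurable_funM.
  have eu x : `|e * u x| = `|u x| by rewrite normrM e1 mul1r.
  apply: gapprox_ge0 => //.
    apply: le_lt_trans lu; apply: le_l12 => // x _.
    rewrite normrM ger0_norm ?invr_ge0// ler_pdivrMl//.
    by rewrite (le_trans (ler_normD _ _))// normr_id eu mulr2n mulrDl mul1r.
  move=> x _; rewrite mulr_ge0 ?invr_ge0//.
  by rewrite -lerBlDr sub0r -eu -normrN ler_norm.
have := gapproxD (H 1 (normr1 _))
  (gapproxZ (-1) (H (-1) (normrN1 _))).
by congr gapprox; apply/funext => x /=; field.
Qed.

End gaussian_density.

(** * Square integrals *)

Section square_integrals.
Context {R : realType} (nu : R).
Local Notation m := (bessel_measure nu).
Local Notation sqint := (@sqint R nu).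
Implicit Types (s t : seq (R * R)) (u v h k : R -> R).

Lemma sqint_ge0 u : (0 <= sqint u)%E.
Proof. by apply: integral_ge0 => x _; rewrite lee_fin sqr_ge0. Qed.

Lemma measurable_sqint_fun u : measurable_fun Rpos u ->
  measurable_fun Rpos (fun x => (u x ^+ 2)%:E).
Proof. by move=> mu; apply/measurable_EFinP; exact: measurable_funX. Qed.

Lemma eq_sqint u v : (forall x, Rpos x -> u x = v x) -> sqint u = sqint v.
Proof. by move=> uv; apply: eq_integral => x /set_mem/uv ->. Qed.

Lemma sqint_le_l12 u : measurable_fun Rpos u -> (sqint u <= l12 nu u)%E.
Proof.
move=> mu; apply: ge0_le_integral => //.
- by move=> x _; rewrite lee_fin sqr_ge0.
- exact: measurable_sqint_fun.
- exact: measurable_l12_fun.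
- by move=> x _; rewrite lee_fin lerDr.
Qed.

Lemma sqint_ae_le u v : measurable_fun Rpos u -> measurable_fun Rpos v ->
  {ae m, forall x, Rpos x -> `|u x| <= `|v x|} -> (sqint u <= sqint v)%E.
Proof.
move=> mu mv uv; apply: ae_ge0_le_integral => //.
- by move=> x _; rewrite lee_fin sqr_ge0.
- exact: measurable_sqint_fun.
- by move=> x _; rewrite lee_fin sqr_ge0.
- exact: measurable_sqint_fun.
- apply: filterS uv => x /[apply] uv; rewrite lee_fin.
  by rewrite -real_normK ?num_real// -[leRHS]real_normK ?num_real// ler_sqr ?nnegrE.
Qed.

(* [2 a b <= d a^2 + b^2 / d] *)
Lemma sqint_addl (d : R) u v : 0 < d ->
  measurable_fun Rpos u -> measurable_fun Rpos v ->
  (sqint (u \+ v)%R <= (1 + d)%:E * sqint u + (1 + d^-1)%:E * sqint v)%E.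
Proof.
move=> d0 mu mv.
have d1 : 0 <= 1 + d by rewrite addr_ge0// ltW.
have d2 : 0 <= 1 + d^-1 by rewrite addr_ge0// invr_ge0 ltW.
rewrite /sqint -!ge0_integralZl ?lee_fin//; last 4 first.
- exact: measurable_sqint_fun.
- by move=> x _; rewrite lee_fin sqr_ge0.
- exact: measurable_sqint_fun.
- by move=> x _; rewrite lee_fin sqr_ge0.
rewrite -ge0_integralD//; last 4 first.
- by move=> x _; rewrite -EFinM lee_fin mulr_ge0 ?sqr_ge0.
- by apply: emeasurable_funM => //; exact: measurable_sqint_fun.
- by move=> x _; rewrite -EFinM lee_fin mulr_ge0 ?sqr_ge0.
- by apply: emeasurable_funM => //; exact: measurable_sqint_fun.
apply: ge0_le_integral => //.
- by move=> x _; rewrite lee_fin sqr_ge0.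
- by apply: (@measurable_sqint_fun (u \+ v)); exact: measurable_funD.
- apply: emeasurable_funD; apply: emeasurable_funM => //; exact: measurable_sqint_fun.
- move=> x _; rewrite -!EFinM -EFinD lee_fin /= -subr_ge0.
  rewrite [leRHS](_ : _ = d^-1 * (d * u x - v x) ^+ 2).
    by rewrite mulr_ge0 ?sqr_ge0// invr_ge0 ltW.
  by field; rewrite gt_eqF.
Qed.

Lemma sqintD u v : measurable_fun Rpos u -> measurable_fun Rpos v ->
  (sqint (u \+ v)%R <= 2%:E * sqint u + 2%:E * sqint v)%E.
Proof.
move=> mu mv; have := @sqint_addl 1 u v ltr01 mu mv.
by rewrite invr1 -[1 + 1]/(2%:R).
Qed.

Lemma sqintZ c u : measurable_fun Rpos u ->
  sqint (fun x => c * u x) = ((c ^+ 2)%:E * sqint u)%E.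
Proof.
move=> mu; rewrite /sqint -ge0_integralZl ?lee_fin ?sqr_ge0//.
- by apply: eq_integral => x _; rewrite exprMn.
- exact: measurable_sqint_fun.
- by move=> x _; rewrite lee_fin sqr_ge0.
Qed.

Lemma sqintB_sym u v : sqint (u \- v) = sqint (v \- u).
Proof. by apply: eq_integral => x _ /=; rewrite -sqrrN opprB. Qed.

Lemma sqintB u v h : measurable_fun Rpos u -> measurable_fun Rpos v ->
  measurable_fun Rpos h ->
  (sqint (u \- v)%R <= 2%:E * sqint (u \- h)%R + 2%:E * sqint (v \- h)%R)%E.
Proof.
move=> mu mv mh; rewrite (sqintB_sym v h).
rewrite (_ : u \- v = (u \- h) \+ (h \- v)); last first.
  by apply/funext => x /=; rewrite addrA subrK.
by apply: sqintD; exact: measurable_funB.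
Qed.

Lemma sqint_lty_D u v : measurable_fun Rpos u -> measurable_fun Rpos v ->
  (sqint u < +oo)%E -> (sqint v < +oo)%E -> (sqint (u \+ v)%R < +oo)%E.
Proof.
move=> mu mv u0 v0; apply: (le_lt_trans (sqintD mu mv)).
by rewrite lte_add_pinfty// lte_mul_pinfty// lee_fin.
Qed.

Lemma sqint_eq0 u : measurable_fun Rpos u -> sqint u = 0%E ->
  {ae m, forall x, Rpos x -> u x = 0}.
Proof.
move=> mu u0.
have mu2 := measurable_sqint_fun mu.
have : (\int[m]_(x in Rpos) `|(u x ^+ 2)%:E| = 0)%E.
  by rewrite -u0; apply: eq_integral => x _; rewrite gee0_abs// lee_fin sqr_ge0.
move/(ae_eq_integral_abs m (@measurable_Rpos R) mu2).
apply: filterS => x /[apply] /= -[] /eqP.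
by rewrite sqrf_eq0 => /eqP.
Qed.

(** An L^2 bound uniform in [n] survives almost everywhere convergence, by Fatou's lemma for
    [(u_ n - v)^2]. This is how pointwise limits of transforms are recognized as L^2 limits. *)
Lemma sqint_fatou (u_ : (R -> R)^nat) u v (e : R) :
  (forall n, measurable_fun Rpos (u_ n)) -> measurable_fun Rpos u ->
  measurable_fun Rpos v ->
  {ae m, forall x, Rpos x -> u_ ^~ x @ \oo --> u x} ->
  (forall n, (sqint (u_ n \- v)%R <= e%:E)%E) -> (sqint (u \- v)%R <= e%:E)%E.
Proof.
move=> mu_ mu mv u_u H; pose f n x := ((u_ n x - v x) ^+ 2)%:E.
have mf n : measurable_fun Rpos (f n).
  by apply: (@measurable_sqint_fun (u_ n \- v)); exact: measurable_funB.
have f0 n x : Rpos x -> (0 <= f n x)%E by move=> _; rewrite lee_fin sqr_ge0.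
apply: (@le_trans _ _ (\int[m]_(x in Rpos) limn_einf (f ^~ x))%E).
  rewrite le_eqVlt; apply/orP; left; apply/eqP.
  apply: ge0_ae_eq_integral => //.
  - by apply: (@measurable_sqint_fun (u \- v)); exact: measurable_funB.
  - rewrite (_ : (fun x => _) = (fun x => - limn_esup (fun n => - f n x))%E).
      apply: measurableT_comp => //; apply: measurable_fun_limn_esup => n.
      exact: measurableT_comp.
    by apply/funext => x; rewrite limn_esupN oppeK.
  - by move=> x _; rewrite lee_fin sqr_ge0.
  - move=> x Rx; rewrite limn_einf_lim; apply: lime_ge; first exact: is_cvg_einfs.
    by apply: nearW => n; apply: le_ereal_inf_tmp => _ [k _ <-]; exact: f0.
  - apply: filterS u_u => x /[apply] ux.
    have h : f ^~ x @ \oo --> ((u x - v x) ^+ 2)%:E.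
      apply: cvg_EFin; first exact: nearW.
      have : (u_ n x - v x) @[n --> \oo] --> u x - v x.
        by apply: cvgB => //; exact: cvg_cst.
      by move=> h; rewrite expr2; under eq_cvg do rewrite /= expr2; exact: cvgM.
    rewrite is_cvg_limn_einfE; last by apply/cvg_ex; eexists; exact: h.
    by apply/esym/cvg_lim.
apply: (le_trans (fatou m (@measurable_Rpos R) mf f0)).
rewrite limn_einf_lim; apply: lime_le; first exact: is_cvg_einfs.
apply: nearW => n; apply: (@le_trans _ _ (\int[m]_(x in Rpos) f n x)%E); last exact: H.
by apply: ereal_inf_lbound; exists n => /=.
Qed.

Hypothesis nu_gt : - (1 / 2) < nu.

(** A square-integrable function need not be integrable. It is first cut off to a bounded interval,
    where [|u| <= (u^2 + 1) / 2] makes [l12] finite. *)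
Lemma sqint_gval_dense u (e : R) : measurable_fun Rpos u -> (sqint u < +oo)%E ->
  0 < e -> exists2 s, gpos s & (sqint (u \- gval s)%R <= e%:E)%E.
Proof.
move=> mu lu e0; pose I n : set R := `]-oo, n.+1%:R[%classic.
have mI n : measurable (I n) by exact: measurable_itv.
have mInd n : measurable_fun Rpos (\1_(I n) : R -> R) by exact: measurable_indic.
pose u_ n x := u x * \1_(I n) x.
have mu_ n : measurable_fun Rpos (u_ n) by exact: measurable_funM.
have lu_ n : (l12 nu (u_ n) < +oo)%E.
  have [_ lI] := @gapprox_ray _ _ nu_gt n.+1%:R (ltr0Sn _ _).
  apply: (@le_lt_trans _ _ (2%:E * sqint u + l12 nu (\1_(I n)))%E); last first.
    by rewrite lte_add_pinfty// lte_mul_pinfty// lee_fin.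
  rewrite /sqint -ge0_integralZl ?lee_fin//; last 2 first.
  - exact: measurable_sqint_fun.
  - by move=> x _; rewrite lee_fin sqr_ge0.
  rewrite /l12 -ge0_integralD//; last 3 first.
  - by move=> x _; rewrite -EFinM lee_fin mulr_ge0 ?sqr_ge0.
  - by apply: emeasurable_funM => //; exact: measurable_sqint_fun.
  - by apply: (@measurable_l12_fun R (\1_(I n))).
  apply: ge0_le_integral => //.
  - by move=> x _; rewrite lee_fin addr_ge0// sqr_ge0.
  - exact: measurable_l12_fun.
  - apply: emeasurable_funD; last exact: measurable_l12_fun.
    by apply: emeasurable_funM => //; exact: measurable_sqint_fun.
  - move=> x _; rewrite -EFinM -EFinD lee_fin /u_ indicE.
    case: (x \in _); rewrite ?mulr1 ?mulr0 ?normr1 ?normr0 ?expr0n ?expr1n ?addr0.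
      have : u x ^+ 2 = `|u x| ^+ 2 by rewrite real_normK ?num_real.
      by have := sqr_ge0 (`|u x| - 1); nra.
    by rewrite mulr_ge0 ?sqr_ge0.
pose f n x := ((u x - u_ n x) ^+ 2)%:E.
have mf n : measurable_fun Rpos (f n).
  by apply: (@measurable_sqint_fun (u \- u_ n)); exact: measurable_funB.
have ig : m.-integrable Rpos (fun x => (u x ^+ 2)%:E).
  apply/integrableP; split; first exact: measurable_sqint_fun.
  by under eq_integral do rewrite gee0_abs ?lee_fin ?sqr_ge0//.
have f0 : {ae m, forall x, Rpos x -> f ^~ x @ \oo --> 0%E}.
  apply: aeW => x _; apply: cvg_EFin; first exact: nearW.
  have h : (u x - u_ n x) @[n --> \oo] --> (0 : R).
    rewrite -[X in _ --> X](subrr (u x)); apply: cvgB; first exact: cvg_cst.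
    exact: indic_ray_cvg.
  rewrite -[X in _ --> X](mulr0 0).
  under eq_cvg do rewrite /= expr2; exact: cvgM.
have fg : {ae m, forall x n, Rpos x -> (`|f n x| <= (u x ^+ 2)%:E)%E}.
  apply: aeW => x n _; rewrite gee0_abs ?lee_fin ?sqr_ge0// /u_ indicE.
  by case: (x \in _); rewrite ?mulr1 ?mulr0 ?subrr ?subr0 ?expr0n ?sqr_ge0.
have [_ _] := dominated_convergence (@measurable_Rpos R) mf
  (@measurable_cst _ _ _ _ _ 0%E) f0 ig fg.
rewrite integral0 => cv.
have e4 : 0 < e / 4 by rewrite divr_gt0.
have : \forall n \near \oo, (sqint (u \- u_ n)%R < (e / 4)%:E)%E.
  by apply: (cv [set y | (y < (e / 4)%:E)%E]);
    exact: (@nbhs_open_ereal_lt R 0 (fun=> e / 4) e4).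
move=> [N _ /(_ N (leqnn N)) /ltW hN].
have [_ /(_ _ e4) [s s0 hs]] := gapprox_l12 nu_gt (mu_ N) (lu_ N).
have ms := @measurable_gval R s Rpos (@measurable_Rpos R).
exists s => //.
rewrite (_ : u \- gval s = (u \- u_ N) \+ (u_ N \- gval s)); last first.
  by apply/funext => x /=; rewrite addrA subrK.
apply: (le_trans (sqintD (measurable_funB mu (mu_ N)) (measurable_funB (mu_ N) ms))).
rewrite (_ : e%:E = 2%:E * (e / 4)%:E + 2%:E * (e / 4)%:E)%E; last first.
  by rewrite -!EFinM -EFinD; congr EFin; field.
apply: leeD; rewrite lee_wpmul2l// ?lee_fin//.
by apply: le_trans hs; apply: sqint_le_l12; exact: measurable_funB.
Qed.

End square_integrals.

(** * The transform on square-integrable functions *)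

Section hankel_closure.
Context {R : realType} (nu : R).
Hypothesis nu_gt : - (1 / 2) < nu.
Local Notation m := (bessel_measure nu).
Local Notation sqint := (@sqint R nu).
Local Notation hankel := (@hankel R nu).
Local Notation gdual := (@gdual R nu).
Implicit Types (s t : seq (R * R)) (u v h k : R -> R).

Let mgval s : measurable_fun Rpos (gval s).
Proof. exact: measurable_gval. Qed.
#[local] Hint Resolve mgval : core.

(** The weights [4^n] turn the rate [16^-n] into summable integrals [4^-n], so the sum of
    [4^n (d n)^2] is finite almost everywhere. There [d n] is of order [2^-n] and the telescoping
    series converges absolutely. *)
Lemma fast_cauchy_ae_cvg (h : (R -> R)^nat) :
  (forall n, measurable_fun Rpos (h n)) ->
  (forall n, (sqint (h n.+1 \- h n)%R <= (16^-1 ^+ n)%:E)%E) ->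
  exists2 l : R -> R, measurable_fun Rpos l &
    {ae m, forall x, Rpos x -> h ^~ x @ \oo --> l x}.
Proof.
move=> mh hh; pose d n x := h n.+1 x - h n x.
have md n : measurable_fun Rpos (d n) by exact: measurable_funB.
pose f n x := (4 ^+ n * d n x ^+ 2)%:E.
have f0 n x : (0 <= f n x)%E by rewrite lee_fin mulr_ge0 ?sqr_ge0// exprn_ge0.
have mf n : measurable_fun Rpos (f n).
  by apply/measurable_EFinP; apply: measurable_funM => //; exact: measurable_funX.
pose T x := (\sum_(0 <= n <oo) f n x)%E.
have T0 x : (0 <= T x)%E by apply: nneseries_ge0 => n _ _; exact: f0.
have iT : m.-integrable Rpos T.
  apply/integrableP; split; first exact: ge0_emeasurable_sum.
  under eq_integral do rewrite gee0_abs//.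
  rewrite /T integral_nneseries//.
  apply: (@le_lt_trans _ _ (\sum_(0 <= n <oo) (4^-1 ^+ n)%:E)%E).
    apply: lee_nneseries => n _.
      by move=> _; apply: integral_ge0.
    apply: (@le_trans _ _ ((4 ^+ n)%:E * sqint (d n))%E).
      rewrite /sqint -ge0_integralZl ?lee_fin ?exprn_ge0//.
      - exact: measurable_sqint_fun.
      - by move=> x _; rewrite lee_fin sqr_ge0.
    rewrite (_ : 4^-1 ^+ n = 4 ^+ n * 16^-1 ^+ n); last first.
      by rewrite -exprMn; congr (_ ^+ n); field.
    by rewrite EFinM lee_wpmul2l ?lee_fin ?exprn_ge0//; exact: hh.
  rewrite (_ : (fun n => _) = EFin \o series (geometric 1 (4^-1 : R))); last first.
    apply/funext => n; rewrite /series /= sumEFin; congr EFin.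
    by apply: eq_bigr => i _; rewrite mul1r.
  rewrite EFin_lim ?ltry//; apply: is_cvg_geometric_series.
  by rewrite ger0_norm ?invr_ge0// invf_lt1// ltr1n.
have aeT := integrable_ae (@measurable_Rpos R) iT.
(* An upper limit is measurable on all of [Rpos], including the points where the sequence
   diverges. *)
pose l x := fine (limn_esup (fun n => (h n x)%:E)).
exists l.
  apply: (@measurable_comp _ _ _ _ _ _ setT) => //.
  by apply: measurable_fun_limn_esup => n; exact/measurable_EFinP.
apply: filterS aeT => x /[apply] Tfin.
have [t tE] : exists t : R, T x = t%:E by exists (fine (T x)); rewrite fineK.
have t0 : 0 <= t by rewrite -lee_fin -tE.
have ft n : 4 ^+ n * d n x ^+ 2 <= t.
  rewrite -lee_fin -tE -/(f n x).
  apply: (@le_trans _ _ (\sum_(0 <= i < n.+1) f i x)%E).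
    by rewrite big_nat_recr//= leeDr// sume_ge0.
  by apply: nneseries_lim_ge => i _ _; exact: f0.
(* Here [1 + t] stands in for the square root of [t], as [t <= (1 + t)^2]. *)
have dn n : `|d n x| <= (1 + t) * 2^-1 ^+ n.
  have p2 : 0 < 2 ^+ n :> R by rewrite exprn_gt0.
  rewrite exprVn ler_pdivlMr// -ler_sqr ?nnegrE ?mulr_ge0 ?addr_ge0 ?(ltW p2)//.
  rewrite exprMn real_normK ?num_real// mulrC -exprM mulnC exprM.
  have -> : 2 ^+ 2 = 4 :> R by rewrite -natrX.
  by rewrite (le_trans (ft n))//; nra.
have cvgd : cvgn (series (fun n => d n x)).
  apply: normed_cvg.
  apply: (@series_le_cvg _ _ (geometric (1 + t) (2^-1 : R))) => //.
    by move=> n; exact: normr_ge0.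
    by move=> n; rewrite /geometric/= mulr_ge0 ?addr_ge0// exprn_ge0 ?invr_ge0.
  apply: is_cvg_geometric_series.
  by rewrite ger0_norm ?invr_ge0// invf_lt1// ltr1n.
have /cvg_ex[c hc] : cvgn (h ^~ x).
  rewrite (_ : h ^~ x = cst (h 0 x) \+ series (fun n => d n x)); last first.
    by apply/funext => n; exact: (eq_sum_telescope (h ^~ x)).
  by apply: is_cvgD => //; exact: is_cvg_cst.
suff -> : l x = c by [].
rewrite /l; have hE : (fun n => (h n x)%:E) @ \oo --> c%:E.
  by apply: cvg_EFin => //; exact: nearW.
rewrite is_cvg_limn_esupE; last by apply/cvg_ex; exists c%:E.
by rewrite (cvg_lim _ hE).
Qed.

(* The closure in L^2 x L^2 of the graph of the transform on Gaussians. *)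
Definition hrel u h : Prop := [/\ measurable_fun Rpos u, measurable_fun Rpos h &
  forall e : R, 0 < e -> exists s, [/\ gpos s,
    (sqint (u \- gval s)%R <= e%:E)%E &
    (sqint (h \- gval (gdual s))%R <= e%:E)%E]].

Lemma hrel_sym u h : hrel u h -> hrel h u.
Proof.
move=> [mu mh H]; split => // e /H[s [s0 us hs]].
by exists (gdual s); rewrite gpos_dual gdualK.
Qed.

Lemma sqint_gval_lty s : gpos s -> (sqint (gval s) < +oo)%E.
Proof. by move=> s0; rewrite sqint_gval// ltry. Qed.

Lemma hrel_lty u h : hrel u h -> (sqint u < +oo)%E.
Proof.
move=> [mu mh /(_ 1 ltr01)[s [s0 us _]]].
rewrite (_ : u = (u \- gval s) \+ gval s); last first.
  by apply/funext => x /=; rewrite subrK.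
apply: sqint_lty_D => //; first exact: measurable_funB.
  by rewrite (le_lt_trans us)// ltry.
exact: sqint_gval_lty.
Qed.

Let hrel_isometry_le u h : hrel u h -> (sqint h <= sqint u)%E.
Proof.
move=> uh; have [mu mh H] := uh; have := hrel_lty uh.
case uE : (sqint u) (sqint_ge0 nu u) => [a| |]// a0 _; rewrite lee_fin in a0.
apply/lee_addgt0Pr => e e0.
(* For [d <= 1] the two uses of [sqint_addl] cost at most [3 a d + 6 d = d c] in total; the
   approximation error is taken to be [d^2] so that it absorbs the factor [1 + 1/d]. *)
pose c := 3 * a + 6.
have c0 : 0 < c by rewrite /c; lra.
pose d := Num.min 1 (e / c).
have d0 : 0 < d by rewrite /d lt_min ltr01 divr_gt0.
have d1 : d <= 1 by rewrite /d ge_min lexx.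
have dc : d * c <= e by rewrite -ler_pdivlMr// /d ge_min lexx orbT.
have d20 : 0 < d ^+ 2 by rewrite exprn_gt0.
have [s [s0 us hs]] := H _ d20.
have m1 : measurable_fun Rpos (gval s \- u) by exact: measurable_funB.
have m2 : measurable_fun Rpos (h \- gval (gdual s)) by exact: measurable_funB.
have p1 : 0 <= 1 + d by rewrite addr_ge0// ltW.
have p2 : 0 <= 1 + d^-1 by rewrite addr_ge0// invr_ge0 ltW.
have gs : (sqint (gval s) <= ((1 + d) * a + (1 + d^-1) * d ^+ 2)%:E)%E.
  rewrite (_ : gval s = u \+ (gval s \- u)); last first.
    by apply/funext => x /=; rewrite addrC subrK.
  apply: (le_trans (sqint_addl nu d0 mu m1)); rewrite uE [leRHS]EFinD !EFinM.
  by apply: leeD => //; rewrite lee_wpmul2l ?lee_fin// sqintB_sym.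
rewrite (_ : h = gval (gdual s) \+ (h \- gval (gdual s))); last first.
  by apply/funext => x /=; rewrite addrC subrK.
apply: (le_trans (sqint_addl nu d0 (mgval _) m2)).
apply: (@le_trans _ _ ((1 + d) * ((1 + d) * a + (1 + d^-1) * d ^+ 2) +
                       (1 + d^-1) * d ^+ 2)%:E).
  rewrite [leRHS]EFinD (EFinM (1 + d)) (EFinM (1 + d^-1)).
  by apply: leeD; rewrite lee_wpmul2l ?lee_fin// sqint_gdual.
rewrite -EFinD lee_fin.
have -> : (1 + d^-1) * d ^+ 2 = d ^+ 2 + d by field; rewrite gt_eqF.
by move: dc; rewrite /c; have := mulr_ge0 (ltW d0) a0; nra.
Qed.

Lemma hrel_isometry u h : hrel u h -> sqint h = sqint u.
Proof.
move=> uh; apply/eqP; rewrite eq_le hrel_isometry_le//.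
by rewrite hrel_isometry_le//; exact: hrel_sym.
Qed.

Lemma hrel_lin c u v h k : hrel u h -> hrel v k ->
  hrel (fun x => c * u x + v x) (fun x => c * h x + k x).
Proof.
move=> [mu mh H] [mv mk K].
have mc (w : R -> R) : measurable_fun Rpos w -> measurable_fun Rpos (fun x => c * w x).
  by move=> mw; exact: measurable_funM.
split; try by apply: measurable_funD => //; exact: mc.
move=> e e0; have c1 : 0 < c ^+ 2 + 1 by rewrite ltr_wpDl// sqr_ge0.
pose d := e / (4 * (c ^+ 2 + 1)).
have d0 : 0 < d by rewrite divr_gt0// mulr_gt0.
have key (w z : R -> R) s t : measurable_fun Rpos w -> measurable_fun Rpos z ->
    (sqint (w \- gval s)%R <= d%:E)%E -> (sqint (z \- gval t)%R <= d%:E)%E ->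
    (sqint ((fun x => c * w x + z x) \- gval (gscale c s ++ t))%R <= e%:E)%E.
  move=> mw mz ws zt.
  have -> : (fun x => c * w x + z x) \- gval (gscale c s ++ t) =
      (fun x => c * (w \- gval s) x) \+ (z \- gval t).
    by apply/funext => x /=; rewrite gval_cat gval_scale; ring.
  have mws : measurable_fun Rpos (w \- gval s) by exact: measurable_funB.
  have mzt : measurable_fun Rpos (z \- gval t) by exact: measurable_funB.
  apply: (le_trans (sqintD nu (@mc _ mws) mzt)); rewrite sqintZ//.
  apply: (@le_trans _ _ (2%:E * ((c ^+ 2)%:E * d%:E) + 2%:E * d%:E)%E).
    by apply: leeD; rewrite !lee_wpmul2l ?lee_fin ?sqr_ge0.
  rewrite -!EFinM -EFinD lee_fin.
  rewrite [leLHS](_ : _ = e / 2); first lra.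
  by rewrite /d; field; rewrite gt_eqF.
have [s [s0 us hs]] := H _ d0; have [t [t0 vt kt]] := K _ d0.
exists (gscale c s ++ t); split; first by rewrite gpos_cat gpos_scale s0.
  exact: key.
by rewrite gdual_cat gdual_scale; exact: key.
Qed.

(** A difference of two combinations is again a combination, so linearity of [gdual] on codes turns
    equality of norms into equality of distances. *)
Let sqint_gdualB s t : gpos s -> gpos t ->
  sqint (gval (gdual s) \- gval (gdual t)) = sqint (gval s \- gval t).
Proof.
move=> s0 t0.
have E (a b : seq (R * R)) : gval a \- gval b = gval (a ++ gscale (-1) b).
  by apply/funext => x /=; rewrite gval_cat gval_scale mulN1r.
by rewrite !E -gdual_scale -gdual_cat sqint_gdual// gpos_cat s0 gpos_scale.
Qed.

Lemma hrel_total u : measurable_fun Rpos u -> (sqint u < +oo)%E ->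
  exists h, hrel u h.
Proof.
move=> mu lu.
(* The duals then differ by at most [2 eps + 2 eps = 16^-n], the rate that [fast_cauchy_ae_cvg] asks
   for. *)
pose eps n : R := 16^-1 ^+ n / 4.
have eps0 n : 0 < eps n by rewrite divr_gt0// exprn_gt0// invr_gt0.
have /choice[s hs] : forall n, exists s, gpos s /\
    (sqint (u \- gval s)%R <= (eps n)%:E)%E.
  by move=> n; have [s s0 us] := sqint_gval_dense nu_gt mu lu (eps0 n); exists s.
have s0 n : gpos (s n) by have [] := hs n.
have us n : (sqint (u \- gval (s n))%R <= (eps n)%:E)%E by have [] := hs n.
have eps_le n p : (n <= p)%N -> eps p <= eps n.
  move=> np; rewrite /eps ler_pM2r ?invr_gt0//.
  by rewrite ler_wiXn2l ?invr_ge0// invf_le1// ler1n.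
have ss n p : (n <= p)%N ->
    (sqint (gval (gdual (s p)) \- gval (gdual (s n)))%R <= (16^-1 ^+ n)%:E)%E.
  move=> np; rewrite sqint_gdualB//.
  apply: (le_trans (sqintB nu (mgval _) (mgval _) mu)).
  rewrite (sqintB_sym nu (gval (s p))) (sqintB_sym nu (gval (s n))).
  apply: (@le_trans _ _ (2%:E * (eps n)%:E + 2%:E * (eps n)%:E)%E).
    apply: leeD; rewrite lee_wpmul2l ?lee_fin//.
    by rewrite (le_trans (us p))// lee_fin eps_le.
  by rewrite -EFinM -EFinD lee_fin /eps; move: (_ ^+ n) => y; lra.
have [h mh hh] := @fast_cauchy_ae_cvg (fun n => gval (gdual (s n)))
  (fun n => mgval _) (fun n => ss n n.+1 (leqnSn n)).
exists h; split => // e e0.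
have [n hn] : exists n, 16^-1 ^+ n <= e :> R.
  have : (16^-1 ^+ n) @[n --> \oo] --> (0 : R).
    by apply: cvg_expr; rewrite ger0_norm ?invr_ge0// invf_lt1// ltr1n.
  move=> /cvgrPdist_lt /(_ _ e0)[n _ /(_ n (leqnn n))] /=.
  by rewrite sub0r normrN => /ltW h16; exists n; exact: le_trans (ler_norm _) h16.
exists (s n); split => //.
  rewrite (le_trans (us n))// lee_fin (le_trans _ hn)// /eps.
  by rewrite ler_pdivrMr// ler_peMr ?ler1n// exprn_ge0// invr_ge0.
(* All later duals lie within [16^-n] of the one of index [n]; Fatou's lemma carries this over to
   their limit [h]. *)
apply: (@sqint_fatou _ _ (fun p => gval (gdual (s (n + p)%N)))) => //.
  apply: filterS hh => x /[apply] hx.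
  rewrite (_ : (fun _ => _) = (fun p => gval (gdual (s (p + n)%N)) x)).
    by rewrite (cvg_shiftn n (fun p => gval (gdual (s p)) x)).
  by apply/funext => p; rewrite addnC.
by move=> p; rewrite (le_trans (ss _ _ (leq_addr p n)))// lee_fin.
Qed.

Lemma hrel_hankel u : measurable_fun Rpos u -> (l12 nu u < +oo)%E ->
  hrel u (hankel u).
Proof.
move=> mu lu; have [_ au] := gapprox_l12 nu_gt mu lu.
(* A slow rate suffices: the L^1 part of [l12] and the bound on [psi] give convergence of the
   transforms at each point of [Rpos]. *)
pose eps n : R := n.+1%:R^-1.
have eps0 n : 0 < eps n by rewrite invr_gt0.
have /choice[s hs] : forall n, exists s, gpos s /\
    (l12 nu (u \- gval s)%R <= (eps n)%:E)%E.
  by move=> n; have [s s0 us] := au _ (eps0 n); exists s.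
have s0 n : gpos (s n) by have [] := hs n.
have us n : (l12 nu (u \- gval (s n))%R <= (eps n)%:E)%E by have [] := hs n.
have musn n : measurable_fun Rpos (u \- gval (s n)) by exact: measurable_funB.
have usq n : (sqint (u \- gval (s n))%R <= (eps n)%:E)%E.
  by apply: le_trans (us n); exact: sqint_le_l12.
have iu v : measurable_fun Rpos v -> (l12 nu v < +oo)%E ->
    m.-integrable Rpos (EFin \o v).
  move=> mv lv; apply/integrableP; split; first exact/measurable_EFinP.
  apply: le_lt_trans lv; apply: ge0_le_integral => //.
  - by apply/measurable_EFinP; exact: measurableT_comp.
  - exact: measurable_l12_fun.
  - by move=> x _; rewrite lee_fin lerDl sqr_ge0.
pose C := (moment1 nu 0)^-1.
have C0 : 0 <= C by rewrite invr_ge0 ltW// moment1_gt0.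
have mpsi y : measurable_fun Rpos (fun x => psi nu ((x * y) ^+ 2)).
  apply: (@measurable_fun_cvg _ R R Rpos
    (fun n (x : R) => pseries (psi_coeff nu) ((x * y) ^+ 2) n)
    (fun x : R => psi nu ((x * y) ^+ 2))).
    move=> n; apply: measurable_sum => i; apply: measurable_funM => //.
    apply: measurable_funX; apply: measurable_funX; exact: measurable_funM.
  by move=> x _; exact: cvg_psi_series.
have ipsi v y : m.-integrable Rpos (EFin \o v) ->
    m.-integrable Rpos (EFin \o (fun x => psi nu ((x * y) ^+ 2) * v x)).
  move=> iv; have mv : measurable_fun Rpos v.
    by apply/measurable_EFinP; case/integrableP: iv.
  apply: (le_integrable _ _ _ (integrableZl _ C (integrable_abse iv))) => //.
    by apply/measurable_EFinP; exact: measurable_funM.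
  move=> x _; rewrite /= lee_fin normrM [leRHS]ger0_norm ?mulr_ge0//.
  by rewrite ler_wpM2r//; apply: psi_bound => //; exact: sqr_ge0.
have hcv y : Rpos y -> gval (gdual (s n)) y @[n --> \oo] --> hankel u y.
  move=> _; apply/cvgrPdist_le => e e0.
  have [N hN] : exists N : nat, C / e <= N%:R.
    by exists (Num.truncn (C / e)).+1; rewrite ltW// truncnS_gt.
  exists N => // n /= Nn; have [i1 <-] := hankel_gval nu_gt y (s0 n).
  have i2 := ipsi _ y (iu _ mu lu).
  have lun : (l12 nu (u \- gval (s n))%R < +oo)%E.
    by rewrite (le_lt_trans (us n))// ltry.
  have i3 := iu _ (musn n) lun; have i4 := ipsi _ y i3.
  rewrite /hankel -RintegralB//.
  under eq_Rintegral do rewrite -mulrBr.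
  rewrite (le_trans (le_normr_Rintegral _ i4))//.
  have i5 : m.-integrable Rpos (EFin \o (fun x => C * `|u x - gval (s n) x|)).
    by apply: eq_integrable (integrableZl _ C (integrable_abse i3)).
  apply: (@le_trans _ _ (\int[m]_(x in Rpos) (C * `|u x - gval (s n) x|))).
    apply: le_Rintegral => //.
      by apply: eq_integrable (integrable_abse i4).
    move=> x _; rewrite normrM ler_wpM2r//.
    by apply: psi_bound => //; exact: sqr_ge0.
  have i6 : m.-integrable Rpos (EFin \o (fun x => `|u x - gval (s n) x|)).
    by apply: eq_integrable (integrable_abse i3).
  rewrite RintegralZl// (@le_trans _ _ (C * eps n))//.
    rewrite ler_wpM2l// -lee_fin /Rintegral fineK; last exact: integrable_fin_num.
    apply: le_trans (us n); apply: ge0_le_integral => //.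
    - by apply/measurable_EFinP; exact: (measurableT_comp _ (musn n)).
    - exact: measurable_l12_fun.
    - by move=> x _; rewrite lee_fin lerDl sqr_ge0.
  rewrite /eps ler_pdivrMr// mulrC -ler_pdivrMr// (le_trans hN)// ler_nat.
  by rewrite (leq_trans Nn).
have mh : measurable_fun Rpos (hankel u).
  exact: (@measurable_fun_cvg _ _ _ _ (fun n => gval (gdual (s n)))).
split => // e e0.
have [n hn] : exists n, 4 * eps n <= e.
  exists (Num.truncn (4 / e)).
  by rewrite /eps ler_pdivrMr// mulrC -ler_pdivrMr// ltW// truncnS_gt.
exists (s n); split => //.
  by rewrite (le_trans (usq n))// lee_fin; have := eps0 n; lra.
have eps_le p : eps (n + p) <= eps n.
  by rewrite /eps lef_pV2 ?posrE// ler_nat ltnS leq_addr.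
apply: (@sqint_fatou _ _ (fun p => gval (gdual (s (n + p)%N)))) => //.
  apply: aeW => x Rx.
  rewrite (_ : (fun _ => _) = (fun p => gval (gdual (s (p + n)%N)) x)).
    by rewrite (cvg_shiftn n (fun p => gval (gdual (s p)) x)); exact: hcv.
  by apply/funext => p; rewrite addnC.
move=> p; rewrite sqint_gdualB//.
apply: (le_trans (sqintB nu (mgval _) (mgval _) mu)).
rewrite (sqintB_sym nu (gval (s (n + p)%N))) (sqintB_sym nu (gval (s n))).
apply: (@le_trans _ _ (2%:E * (eps n)%:E + 2%:E * (eps n)%:E)%E).
  apply: leeD; rewrite lee_wpmul2l ?lee_fin//.
  by rewrite (le_trans (usq _))// lee_fin.
by rewrite -EFinM -EFinD lee_fin; lra.
Qed.

End hankel_closure.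

Import Normc.
Local Open Scope complex_scope.

(** * Complex-valued functions and the unitary operator *)

Section complex_lift.
Context {R : realType} (nu : R).
Hypothesis nu_gt : - (1 / 2) < nu.
Local Notation m := (bessel_measure nu).
Local Notation sqint := (@sqint R nu).
Local Notation hrel := (@hrel R nu).
Implicit Types (u v h k : R -> R) (f g : R -> R[i]).

Lemma L2normE f : cmeasurable Rpos f ->
  L2norm nu f = ((sqint (re_fun f) + sqint (im_fun f)) `^ 2^-1)%E.
Proof.
move=> [mr mi]; rewrite /L2norm Lnorm.unlock.
congr (_ `^ _)%E.
rewrite -ge0_integralD//; last 4 first.
- by move=> x _; rewrite lee_fin sqr_ge0.
- exact: measurable_sqint_fun.
- by move=> x _; rewrite lee_fin sqr_ge0.
- exact: measurable_sqint_fun.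
rewrite [RHS]integral_mkcond; apply: eq_integral => x _.
rewrite /= !patchE; case: (x \in _); last by rewrite normr0 powR0.
rewrite /re_fun /im_fun /normc; case: (f x) => a b /=.
rewrite powR_mulrn// real_normK ?num_real//.
by rewrite sqr_sqrtr// addr_ge0// sqr_ge0.
Qed.

Lemma L2P f : L2 nu f <->
  cmeasurable Rpos f /\ (sqint (re_fun f) < +oo)%E /\ (sqint (im_fun f) < +oo)%E.
Proof.
split=> [[mf]|[mf [lr li]]]; last first.
  by split => //; rewrite L2normE// poweR_lty// lte_add_pinfty.
rewrite L2normE// => /lty_poweRy h; split => //.
have {}h : (sqint (re_fun f) + sqint (im_fun f) < +oo)%E by apply: h; rewrite invr_neq0.
split; apply: le_lt_trans h.
  by rewrite leeDl// sqint_ge0.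
by rewrite leeDr// sqint_ge0.
Qed.

(** A chosen representative, since [hrel u] determines its partner only almost everywhere. The
    default value concerns only those [u] that are not measurable or not square-integrable. *)
Definition hankel_ext u : R -> R := xget (cst 0) [set h | hrel u h].

Lemma hankel_extP u : measurable_fun Rpos u -> (sqint u < +oo)%E ->
  hrel u (hankel_ext u).
Proof.
move=> mu lu; have [h uh] := hrel_total nu_gt mu lu.
by apply: (@xgetPex _ _ [set h | hrel u h]); exists h.
Qed.

(** By linearity [- h + k] is related to [- u + u = 0], and the isometry makes its norm vanish. *)
Lemma hrel_unique u h k : hrel u h -> hrel u k ->
  {ae m, forall x, Rpos x -> h x = k x}.
Proof.
move=> uh uk; have H := hrel_lin (-1) uh uk.
have [_ mh _] := H.
have : sqint (fun x => -1 * h x + k x) = 0%E.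
  rewrite (hrel_isometry nu_gt H) (@eq_sqint _ _ _ (cst 0)); last first.
    by move=> x _; rewrite mulN1r addNr.
  by rewrite /sqint; under eq_integral do rewrite expr0n; rewrite integral0.
move=> /(sqint_eq0 mh); apply: filterS => x /[apply].
by rewrite mulN1r addrC => /subr0_eq.
Qed.

Lemma ae_eq_hrel u v h : measurable_fun Rpos v ->
  {ae m, forall x, Rpos x -> u x = v x} -> hrel u h -> hrel v h.
Proof.
move=> mv uv [mu mh H]; split => // e /H[s [s0 us hs]]; exists s; split => //.
apply: le_trans us; apply: sqint_ae_le.
- by apply: measurable_funB => //; exact: measurable_gval.
- by apply: measurable_funB => //; exact: measurable_gval.
- by apply: filterS uv => x /[apply] /= ->.
Qed.

Let integrable_sqr u : measurable_fun Rpos u -> (sqint u < +oo)%E ->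
  m.-integrable Rpos (EFin \o (fun x => u x ^+ 2)).
Proof.
move=> mu lu; apply/integrableP; split; first exact: measurable_sqint_fun.
by under eq_integral do rewrite /= ger0_norm ?sqr_ge0//.
Qed.

Lemma integrable_mul u v : measurable_fun Rpos u -> measurable_fun Rpos v ->
  (sqint u < +oo)%E -> (sqint v < +oo)%E ->
  m.-integrable Rpos (EFin \o (fun x => u x * v x)).
Proof.
move=> mu mv lu lv.
apply: (le_integrable _ _ _
  (integrableD _ (integrable_sqr mu lu) (integrable_sqr mv lv))) => //.
  by apply/measurable_EFinP; exact: measurable_funM.
move=> x _; rewrite /= lee_fin [leRHS]ger0_norm ?addr_ge0 ?sqr_ge0// normrM.
rewrite -(real_normK (num_real (u x))) -(real_normK (num_real (v x))).
by have := sqr_ge0 (`|u x| - `|v x|); have := sqr_ge0 (`|u x| + `|v x|); nra.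
Qed.

(** Polarization: inner products are recovered from norms. The shape [1 * u x + v x] is that of
    [hrel_lin]. *)
Lemma Rintegral_mulE u v : measurable_fun Rpos u -> measurable_fun Rpos v ->
  (sqint u < +oo)%E -> (sqint v < +oo)%E ->
  \int[m]_(x in Rpos) (u x * v x) =
  2^-1 * (fine (sqint (fun x => 1 * u x + v x)) - fine (sqint u) - fine (sqint v)).
Proof.
move=> mu mv lu lv.
have iu := integrable_sqr mu lu; have iv := integrable_sqr mv lv.
have iuv := integrable_mul mu mv lu lv.
have i2 : m.-integrable Rpos (EFin \o (fun x => 2 * (u x * v x))).
  by apply: eq_integrable (integrableZl _ 2 iuv).
have i1 : m.-integrable Rpos (EFin \o (fun x => u x ^+ 2 + v x ^+ 2)).
  exact: (integrableD (@measurable_Rpos R) iu iv).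
have -> : fine (sqint (fun x => 1 * u x + v x)) =
    \int[m]_(x in Rpos) (u x ^+ 2 + v x ^+ 2 + 2 * (u x * v x)).
  by rewrite /Rintegral; congr fine; apply: eq_integral => x _; congr EFin; ring.
rewrite RintegralD// RintegralD// RintegralZl//.
rewrite -[fine (sqint u)]/(\int[m]_(x in Rpos) (u x ^+ 2)).
rewrite -[fine (sqint v)]/(\int[m]_(x in Rpos) (v x ^+ 2)).
by field.
Qed.

Lemma hrel_inner u v h k : hrel u h -> hrel v k ->
  \int[m]_(x in Rpos) (h x * k x) = \int[m]_(x in Rpos) (u x * v x).
Proof.
move=> uh vk; have [mu mh _] := uh; have [mv mk _] := vk.
have lu := hrel_lty nu_gt uh; have lv := hrel_lty nu_gt vk.
have lh := hrel_lty nu_gt (hrel_sym uh); have lk := hrel_lty nu_gt (hrel_sym vk).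
rewrite !Rintegral_mulE// (hrel_isometry nu_gt (hrel_lin 1 uh vk)).
by rewrite (hrel_isometry nu_gt uh) (hrel_isometry nu_gt vk).
Qed.

Definition bessel_unitary f : R -> R[i] :=
  fun x => hankel_ext (re_fun f) x +i* hankel_ext (im_fun f) x.

Definition chrel f g : Prop :=
  hrel (re_fun f) (re_fun g) /\ hrel (im_fun f) (im_fun g).

Lemma chrel_unitary f : L2 nu f -> chrel f (bessel_unitary f).
Proof. by move=> /L2P[[mr mi] [lr li]]; split; exact: hankel_extP. Qed.

Lemma chrel_L2 f g : chrel f g -> L2 nu f.
Proof.
move=> [hr hi]; apply/L2P; split; first by split; [case: hr|case: hi].
by split; [exact: (hrel_lty nu_gt hr)|exact: (hrel_lty nu_gt hi)].
Qed.

Lemma chrel_sym f g : chrel f g -> chrel g f.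
Proof. by move=> [hr hi]; split; exact: hrel_sym. Qed.

Lemma chrel_L2norm f g : chrel f g -> L2norm nu g = L2norm nu f.
Proof.
move=> fg; have [[mf _] [mg _]] := (chrel_L2 fg, (chrel_L2 (chrel_sym fg))).
by rewrite !L2normE//; case: fg => /(hrel_isometry nu_gt) -> /(hrel_isometry nu_gt) ->.
Qed.

Lemma ae_eq_complex f g :
  {ae m, forall x, Rpos x -> re_fun f x = re_fun g x} ->
  {ae m, forall x, Rpos x -> im_fun f x = im_fun g x} -> ae_eq_pos nu f g.
Proof.
move=> hr hi; apply: filterS2 hr hi => x hr hi Rx.
by apply/eqP; rewrite eq_complex; apply/andP; split; apply/eqP; [exact: hr|exact: hi].
Qed.

Lemma chrel_unique f g1 g2 : chrel f g1 -> chrel f g2 -> ae_eq_pos nu g1 g2.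
Proof.
by move=> [r1 i1] [r2 i2]; apply: ae_eq_complex;
  [exact: (hrel_unique r1 r2)|exact: (hrel_unique i1 i2)].
Qed.

Lemma ae_eq_chrel (f g h : R -> R[i]) :
  L2 nu g -> ae_eq_pos nu f g -> chrel f h -> chrel g h.
Proof.
move=> /L2P[[mr mi] _] fg [hr hi]; split.
  by apply: ae_eq_hrel hr => //; apply: filterS fg => x /[apply]; rewrite /re_fun => ->.
by apply: ae_eq_hrel hi => //; apply: filterS fg => x /[apply]; rewrite /im_fun => ->.
Qed.

(** The relation acts componentwise, so a complex scalar costs two real combinations: the real part
    of [a f + g] is [Re a Re f + (- Im a Im f + Re g)]. *)
Lemma chrel_lin (a : R[i]) (f g h k : R -> R[i]) : chrel f h -> chrel g k ->
  chrel (fun x => a * f x + g x) (fun x => a * h x + k x).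
Proof.
move=> [fr fi] [gr gi]; case: a => a b; split.
  have := hrel_lin a fr (hrel_lin (- b) fi gr).
  by congr hrel; apply/funext => x; rewrite /re_fun /im_fun;
    [case: (f x) (g x) => ? ? [? ?]|case: (h x) (k x) => ? ? [? ?]]; rewrite /= mulNr addrA.
have := hrel_lin a fi (hrel_lin b fr gi).
by congr hrel; apply/funext => x; rewrite /re_fun /im_fun;
  [case: (f x) (g x) => ? ? [? ?]|case: (h x) (k x) => ? ? [? ?]]; rewrite /= addrA.
Qed.

Lemma L2innerE f g : L2 nu f -> L2 nu g -> L2inner nu f g =
  (\int[m]_(x in Rpos) (re_fun f x * re_fun g x) +
   \int[m]_(x in Rpos) (im_fun f x * im_fun g x)) +i*
  (\int[m]_(x in Rpos) (im_fun f x * re_fun g x) -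
   \int[m]_(x in Rpos) (re_fun f x * im_fun g x)).
Proof.
move=> /L2P[[fr fi] [lfr lfi]] /L2P[[gr gi] [lgr lgi]].
rewrite /L2inner /cintegral -RintegralD//; try exact: integrable_mul.
rewrite -RintegralB//; try exact: integrable_mul.
by congr (_ +i* _); apply: eq_Rintegral => x _; rewrite /re_fun /im_fun;
  case: (f x) (g x) => a b [c d] /=; ring.
Qed.

Lemma chrel_inner (f g h k : R -> R[i]) : chrel f h -> chrel g k ->
  L2inner nu h k = L2inner nu f g.
Proof.
move=> fh gk; rewrite !L2innerE;
  [|exact: (chrel_L2 fh)|exact: (chrel_L2 gk)
   |exact: (chrel_L2 (chrel_sym fh))|exact: (chrel_L2 (chrel_sym gk))].
have [[fr fi] [gr gi]] := (fh, gk).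
by rewrite (hrel_inner fr gr) (hrel_inner fi gi) (hrel_inner fi gr) (hrel_inner fr gi).
Qed.

Lemma bessel_unitaryP : L2_unitary nu bessel_unitary.
Proof.
split.
- by move=> f /chrel_unitary fU; exact: (chrel_L2 (chrel_sym fU)).
- move=> f g lf lg fg; apply: (@chrel_unique g); last exact: chrel_unitary.
  by apply: ae_eq_chrel fg _ => //; exact: chrel_unitary.
- move=> a f g lf lg.
  have H := chrel_lin a (chrel_unitary lf) (chrel_unitary lg).
  by apply: (chrel_unique _ H); apply: chrel_unitary; exact: (chrel_L2 H).
- by move=> f g lf lg; apply: chrel_inner; exact: chrel_unitary.
(* By symmetry of the relation the operator is its own inverse almost everywhere, so the image of
   [g] is a preimage of [g]. *)
- move=> g /chrel_unitary /chrel_sym gU; exists (bessel_unitary g).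
    exact: (chrel_L2 gU).
  by apply: (chrel_unique _ gU); apply: chrel_unitary; exact: (chrel_L2 gU).
Qed.

Lemma eq_hrel u h k : (forall x, Rpos x -> h x = k x) -> hrel u h -> hrel u k.
Proof.
move=> hk [mu mh H]; split => //.
  by apply: eq_measurable_fun mh => x /set_mem/hk.
move=> e /H[s [s0 us hs]]; exists s; split => //.
rewrite -(@eq_sqint _ _ (h \- gval (gdual nu s)))// => x Rx /=.
by rewrite hk.
Qed.

Lemma chrel_fourier_bessel f : L1 nu f -> L2 nu f ->
  chrel f (fourier_bessel nu f).
Proof.
move=> [ir ii] /L2P[[mr mi] [lr li]].
have l12_lty u : measurable_fun Rpos u -> (sqint u < +oo)%E ->
    m.-integrable Rpos (EFin \o u) -> (l12 nu u < +oo)%E.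
  move=> mu lu /integrableP[_ iu]; rewrite /l12.
  under eq_integral do rewrite EFinD.
  rewrite ge0_integralD//; last 3 first.
  - by apply/measurable_EFinP; exact: measurableT_comp.
  - by move=> x _; rewrite lee_fin sqr_ge0.
  - exact: measurable_sqint_fun.
  by rewrite lte_add_pinfty.
have E (x y : R) : Rpos x -> Rpos y -> bessel_phi nu (x * y) = psi nu ((x * y) ^+ 2).
  by move=> /Rpos_gt0 x0 /Rpos_gt0 y0; rewrite bessel_phiE// mulr_gt0.
split.
- apply: eq_hrel (hrel_hankel nu_gt mr (l12_lty _ mr lr ir)) => y Ry.
  rewrite /re_fun /= /hankel; apply: eq_Rintegral => x /set_mem Rx.
  by rewrite /re_fun E//; case: (f x) => a b /=; rewrite mul0r subr0.
- apply: eq_hrel (hrel_hankel nu_gt mi (l12_lty _ mi li ii)) => y Ry.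
  rewrite /im_fun /= /hankel; apply: eq_Rintegral => x /set_mem Rx.
  by rewrite /im_fun E//; case: (f x) => a b /=; rewrite mul0r addr0.
Qed.

End complex_lift.

Theorem theorem7p1 (R : realType) (nu : R) (nu_gt : - (1 / 2) < nu) :
  (forall f : R -> complex R, S_space nu f -> L2 nu (fourier_bessel nu f)) /\
  (forall f : R -> complex R, S_space nu f ->
     L2norm nu (fourier_bessel nu f) = L2norm nu f) /\
  (exists U : (R -> complex R) -> (R -> complex R),
     L2_unitary nu U /\
     forall f : R -> complex R, S_space nu f ->
       ae_eq_pos nu (U f) (fourier_bessel nu f)).
Proof.
have H (f : R -> complex R) : S_space nu f -> chrel nu f (fourier_bessel nu f).
  by move=> [_ lf1 lf2 _ _ _]; exact: chrel_fourier_bessel.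
split => [f Sf|]; first exact: (chrel_L2 nu_gt (chrel_sym (H f Sf))).
split => [f Sf|]; first exact: (chrel_L2norm nu_gt (H f Sf)).
exists (bessel_unitary nu); split; first exact: bessel_unitaryP.
move=> f Sf; apply: (chrel_unique nu_gt _ (H f Sf)).
by apply: chrel_unitary => //; case: Sf.
Qed.
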